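(* Let $X$ be a set, let $\Omega$ be a $\sigma$-algebra of subsets of $X$, let $E$ be a $\sigma$-monotone complete partially ordered vector space, and let $\mu:\Omega\to\overline{E^+}$ be an $\overline{E^+}$-valued measure. (1) $\mathcal L^1(X,\Omega,\mu;\mathbb R)$ is an order ideal of the vector lattice $\mathcal M(X,\Omega;\mathbb R)$. As a consequence, it is a $\sigma$-Dedekind complete vector lattice. (2) The positive operator $f\mapsto\int_X^{\mathrm o}f\,\mathrm d\mu$ from $\mathcal L^1(X,\Omega,\mu;\mathbb R)$ into $E$ is $\sigma$-order continuous. (3) $\mathcal N(X,\Omega,\mu;\mathbb R)$ is a $\sigma$-order ideal of $\mathcal L^1(X,\Omega,\mu;\mathbb R)$.
   Context: All vector spaces are real. A partially ordered vector space $E$ has a proper positive cone $E^+$ (i.e. $E^+\cap(-E^+)=\{0\}$), not required to be generating. $E$ is $\sigma$-monotone complete if every increasing sequence in $E$ that is bounded from above has a supremum in $E$; it is $\sigma$-Dedekind complete if every non-empty at most countably infinite subset that is bounded from above has a supremum in $E$. A positive operator $T:E\to F$ between partially ordered vector spaces is $\sigma$-order continuous if $Tx_n\downarrow0$ in $F$ whenever $x_n\downarrow0$ in $E$. An order ideal $I$ of a vector lattice $L$ is a $\sigma$-order ideal if $f\in I$ whenever $(f_n)$ is a sequence in $I$ with $0\le f_n\uparrow f$ in $L$. Extended space: $\overline{E}=E\cup\{\infty\}$ (disjoint union), ordered by extending the order of $E$ with $x\le\infty$ for all $x\in\overline E$; $\infty+x=x+\infty=\infty$ for all $x\in\overline E$;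 $r\cdot\infty=\infty$ for real $r>0$ and $0\cdot\infty=0$. $\overline{E^+}=E^+\cup\{\infty\}$. Elements of $E$ are called finite. Measure: an $\overline{E^+}$-valued measure on $\Omega$ is a map $\mu:\Omega\to\overline{E^+}$ with $\mu(\emptyset)=0$ and $\mu\big(\bigcup_{n=1}^\infty\Delta_n\big)=\bigvee_{N=1}^\infty\sum_{n=1}^N\mu(\Delta_n)$ in $\overline E$ for every pairwise disjoint sequence $(\Delta_n)$ in $\Omega$ with union in $\Omega$. A property holds for almost all $x\in X$ if the set of points where it fails is contained in some $\Delta\in\Omega$ with $\mu(\Delta)=0$. Order integral: for $\varphi=\sum_{i=1}^n r_i\chi_{\Delta_i}$ with $r_i\in[0,\infty)$ and pairwise disjoint $\Delta_i\in\Omega$ (an elementary function), $\int_X^{\mathrm o}\varphi\,\mathrm d\mu:=\sum_{i=1}^n r_i\mu(\Delta_i)\in\overline{E^+}$ (independent of the representation). For measurable $f:X\to[0,\infty]$, choose any sequence of elementary functions $\varphi_n\uparrow f$ pointwise and put $\int_X^{\mathrm o}f\,\mathrm d\mu:=\bigvee_{n=1}^\infty\int_X^{\mathrm o}\varphi_n\,\mathrm d\mu$ in $\overline E$ (independent of the choice of the sequence). $\mathcal M(X,\Omega;\mathbb R)$ is the vector lattice of all $\Omega$–Borel measurable functions $f:X\to\mathbb R$ with the pointwise order. $\mathcal L^1(X,\Omega,\mu;\mathbb R)$ is the set of $f\in\mathcal M(X,\Omega;\mathbb R)$ with $\int_X^{\mathrm o}|f|\,\mathrm d\mu$ finite; for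 such $f$, write $f=f_1-f_2$ with $f_1,f_2\ge0$ in $\mathcal L^1(X,\Omega,\mu;\mathbb R)$ and put $\int_X^{\mathrm o}f\,\mathrm d\mu:=\int_X^{\mathrm o}f_1\,\mathrm d\mu-\int_X^{\mathrm o}f_2\,\mathrm d\mu\in E$ (independent of the choice). $\mathcal N(X,\Omega,\mu;\mathbb R)$ is the set of $f\in\mathcal M(X,\Omega;\mathbb R)$ with $f(x)=0$ for almost all $x\in X$. *)

(* Defs.v *)
From HB Require Import structures.
From mathcomp Require Import all_boot all_order all_algebra.
From mathcomp Require Import all_classical all_reals all_analysis.

Set Implicit Arguments.
Unset Strict Implicit.
Unset Printing Implicit Defensive.

Import Order.TTheory GRing.Theory Num.Theory.
Import numFieldNormedType.Exports.

Local Open Scope classical_set_scope.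
Local Open Scope ring_scope.

(* The positive cone of E is [set x | 0 <= x]; it is proper because the order
   is antisymmetric, and it need not be generating. *)
HB.mixin Record Zmodule_isPOrderedLmodule (R : realType) E
    of GRing.Lmodule R E & Num.POrderedZmodule E := {
  polmod_leD2r : forall z x y : E, x <= y -> x + z <= y + z ;
  polmod_scale_ge0 : forall (r : R) (x : E), 0 <= r -> 0 <= x -> 0 <= r *: x
}.

#[short(type="porderLmodType")]
HB.structure Definition POrderedLmodule (R : realType) :=
  { E of Zmodule_isPOrderedLmodule R E
       & GRing.Lmodule R E & Num.POrderedZmodule E }.

(* An alias of X -> R, with the pointwise operations and the pointwise order:
   the library puts the order of X -> R in another display than the one that
   porderZmodType requires. *)
Definition rfct (X : Type) (R : realType) : Type := X -> R.

Section function_space.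
Variables (R : realType) (X : Type).

HB.instance Definition _ := GRing.Lmodule.copy (rfct X R) (X -> R).

Definition rfct_le (f g : rfct X R) : bool := `[< forall x, f x <= g x >].

Fact rfct_le_refl : reflexive rfct_le.
Proof. by move=> f; apply/asboolP => x. Qed.

Fact rfct_le_anti : antisymmetric rfct_le.
Proof.
move=> f g /andP[/asboolP fg /asboolP gf]; apply/funext => x.
by apply/eqP; rewrite eq_le fg gf.
Qed.

Fact rfct_le_trans : transitive rfct_le.
Proof.
move=> g f h /asboolP fg /asboolP gh; apply/asboolP => x.
exact: le_trans (fg x) (gh x).
Qed.

HB.instance Definition _ := Order.Le_isPOrder.Build ring_display (rfct X R)
  rfct_le_refl rfct_le_anti rfct_le_trans.

Lemma rfct_leP (f g : rfct X R) :
  reflect (forall x, f x <= g x) (f <= g).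
Proof. exact: asboolP. Qed.

Fact rfct_leD2r (h f g : rfct X R) : f <= g -> f + h <= g + h.
Proof.
move=> /rfct_leP fg; apply/rfct_leP => x.
by rewrite -[leLHS]/(f x + h x) -[leRHS]/(g x + h x) lerD2r.
Qed.

Fact rfct_scale_ge0 (r : R) (f : rfct X R) :
  0 <= r -> 0 <= f -> 0 <= r *: f.
Proof.
move=> r0 /rfct_leP f0; apply/rfct_leP => x.
exact: mulr_ge0 r0 (f0 x).
Qed.

HB.instance Definition _ := Zmodule_isPOrderedLmodule.Build R (rfct X R)
  rfct_leD2r rfct_scale_ge0.

End function_space.

Section relative_bounds.
Context {d : Order.disp_t} {V : porderType d}.
Implicit Types (L S : set V) (u : nat -> V) (x : V).

(* Suprema and infima in L, for the order that L inherits from V. *)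
Definition sup_in L S x :=
  (L `&` ubound S) x /\ lbound (L `&` ubound S) x.

Definition inf_in L S x :=
  (L `&` lbound S) x /\ ubound (L `&` lbound S) x.

Definition increases_to L u x :=
  nondecreasing_seq u /\ sup_in L (range u) x.

Definition decreases_to L u x :=
  nonincreasing_seq u /\ inf_in L (range u) x.

Definition sigma_monotone_complete L := forall u b,
  (forall n, L (u n)) -> nondecreasing_seq u -> L b -> ubound (range u) b ->
  exists x, sup_in L (range u) x.

Definition sigma_Dedekind_complete L := forall S b,
  S `<=` L -> S !=set0 -> countable S -> L b -> ubound S b ->
  exists x, sup_in L S x.

End relative_bounds.

Section ordered_subspaces.
Context {R : realType} {V : porderLmodType R}.
Implicit Types (L I : set V) (f g : V).

Definition is_subspace L := submod_closed (mem L).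

Definition vector_lattice L :=
  is_subspace L /\
  forall f g, L f -> L g ->
    (exists h, sup_in L [set f; g] h) /\ (exists h, inf_in L [set f; g] h).

(* h = |f|, computed in L *)
Definition is_modulus L f h := sup_in L [set f; - f] h.

Definition order_ideal L I :=
  [/\ vector_lattice L, I `<=` L, is_subspace I &
      forall f g af ag, I f -> L g ->
        is_modulus L f af -> is_modulus L g ag -> ag <= af -> I g].

Definition sigma_order_ideal L I :=
  order_ideal L I /\
  forall (u : nat -> V) f,
    (forall n, I (u n)) -> (forall n, 0 <= u n) ->
    L f -> increases_to L u f -> I f.

End ordered_subspaces.

Section operators.
Context {R : realType} {V W : porderLmodType R}.

(* Only the values of T on the subspace L of V matter. *)
Definition positive_operator (L : set V) (T : V -> W) :=
  (forall (a : R) (f g : V), L f -> L g -> T (a *: f + g) = a *: T f + T g) /\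
  (forall f, L f -> 0 <= f -> 0 <= T f).

Definition sigma_order_continuous (L : set V) (T : V -> W) :=
  forall u : nat -> V, (forall n, L (u n)) ->
    decreases_to L u 0 -> decreases_to [set: W] (T \o u) 0.

End operators.

(* E with a largest element adjoined *)
Inductive infext (E : Type) := Fin of E | Infty.
Arguments Fin {E}.
Arguments Infty {E}.

Section infext_choice.
Variable E : Type.

Definition option_of_infext (x : infext E) : option E :=
  if x is Fin e then Some e else None.

Definition infext_of_option (x : option E) : infext E :=
  if x is Some e then Fin e else Infty.

Fact option_of_infextK : cancel option_of_infext infext_of_option.
Proof. by case. Qed.

End infext_choice.

HB.instance Definition _ (E : choiceType) :=
  Choice.copy (infext E) (can_type (@option_of_infextK E)).

Section infext_order.
Context {d : Order.disp_t} {E : porderType d}.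

Definition ext_le (x y : infext E) : bool :=
  match x, y with
  | _, Infty => true
  | Infty, Fin _ => false
  | Fin a, Fin b => (a <= b)%O
  end.

Fact ext_le_refl : reflexive ext_le.
Proof. by case=> //= a. Qed.

Fact ext_le_anti : antisymmetric ext_le.
Proof. by case=> [a|] [b|] //= /le_anti ->. Qed.

Fact ext_le_trans : transitive ext_le.
Proof. by case=> [a|] [b|] [c|] //=; apply: le_trans. Qed.

HB.instance Definition _ := Order.Le_isPOrder.Build d (infext E)
  ext_le_refl ext_le_anti ext_le_trans.

End infext_order.

Section infext_nmodule.
Variable E : nmodType.

Definition ext_add (x y : infext E) : infext E :=
  match x, y with
  | Fin a, Fin b => Fin (a + b)
  | _, _ => Infty
  end.

Fact ext_addA : associative ext_add.
Proof. by case=> [a|] [b|] [c|] //=; rewrite addrA. Qed.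

Fact ext_addC : commutative ext_add.
Proof. by case=> [a|] [b|] //=; rewrite addrC. Qed.

Fact ext_add0 : left_id (Fin 0) ext_add.
Proof. by case=> [a|] //=; rewrite add0r. Qed.

HB.instance Definition _ :=
  GRing.isNmodule.Build (infext E) ext_addA ext_addC ext_add0.

End infext_nmodule.

(* Only used for r >= 0. *)
Definition ext_scale {R : realType} {E : lmodType R} (r : R) (x : infext E)
    : infext E :=
  match x with
  | Fin a => Fin (r *: a)
  | Infty => if r == 0 then Fin 0 else Infty
  end.

Definition ext_finite {E : Type} (x : infext E) := exists e, x = Fin e.

(* The value at Infty is a dummy. *)
Definition fin_val {E : nmodType} (x : infext E) : E :=
  if x is Fin e then e else 0.

Section order_integral.
Context {R : realType} {E : porderLmodType R}.
Context {X : Type}.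
(* Measurability is relative to an explicit Omega, and not to a
   measurableType, since the latter would force X to be nonempty. *)
Variables (Omega : set (set X)) (mu : set X -> infext E).

(* The values of mu outside Omega are irrelevant. *)
Record is_measure : Prop := IsMeasure {
  is_measure_ge0 : forall D, Omega D -> Fin 0 <= mu D ;
  is_measure0 : mu set0 = Fin 0 ;
  is_measure_bigcup : forall D : nat -> set X,
    (forall n, Omega (D n)) -> trivIset setT D -> Omega (\bigcup_n D n) ->
    supremums (range (fun N => \sum_(n < N.+1) mu (D n))) (mu (\bigcup_n D n))
}.

Definition almost_all (P : X -> Prop) :=
  exists D, [/\ Omega D, mu D = Fin 0 & [set x | ~ P x] `<=` D].

Definition measurable_wrt {dY} {Y : measurableType dY} (f : X -> Y) :=
  forall B, measurable B -> Omega (f @^-1` B).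

Definition elementary_repr (phi : X -> R) (n : nat) (r : 'I_n -> R)
    (D : 'I_n -> set X) :=
  [/\ forall i, 0 <= r i, forall i, Omega (D i), trivIset setT D &
      forall x, phi x = \sum_(i < n) r i * \1_(D i) x].

Definition elementary (phi : X -> R) :=
  exists n r D, @elementary_repr phi n r D.

(* The integral is well defined, so we pick the value given by an arbitrary
   representation of phi, and below by an arbitrary approximating sequence. *)
Definition elementary_integral (phi : X -> R) : infext E :=
  xget Infty [set v | exists n r D, @elementary_repr phi n r D /\
                        v = \sum_(i < n) ext_scale (r i) (mu (D i))].

Definition elementary_approx (phi : nat -> X -> R) (f : X -> \bar R) :=
  [/\ forall n, elementary (phi n),
      forall x, nondecreasing_seq (phi ^~ x) &
      forall x, (phi n x)%:E @[n --> \oo] --> f x].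

(* Meaningful for measurable f >= 0. *)
Definition order_integral_ge0 (f : X -> \bar R) : infext E :=
  xget Infty [set v | exists phi, elementary_approx phi f /\
                supremums (range (fun n => elementary_integral (phi n))) v].

Definition Mspace : set (rfct X R) := [set f | measurable_wrt f].

Definition L1space : set (rfct X R) :=
  [set f | Mspace f /\ ext_finite (order_integral_ge0 (fun x => `|f x|%:E))].

Definition Nspace : set (rfct X R) :=
  [set f | Mspace f /\ almost_all (fun x => f x = 0)].

(* Meaningful for f in L1space. *)
Definition order_integral (f : rfct X R) : E :=
  xget 0 [set v | exists f1 f2 : rfct X R,
    [/\ L1space f1 /\ 0 <= f1, L1space f2 /\ 0 <= f2, f = f1 - f2 &
        v = fin_val (order_integral_ge0 (EFin \o f1))
            - fin_val (order_integral_ge0 (EFin \o f2))]].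

End order_integral.

(* Main.v *)
Require Import Defs.
From HB Require Import structures.
From mathcomp Require Import all_boot all_order all_algebra.
From mathcomp Require Import all_classical all_reals all_analysis.
From mathcomp Require Import measurable_realfun.

(** The order of E need not be a lattice order and E carries no norm, so the
    usual theory of the Lebesgue integral is redone with two tools only: an
    increasing sequence in the extended space has a supremum
    ([ext_sup_exists]), compatible with sums and positive multiples
    ([ext_supD], [ext_supZ]); and sigma-monotone completeness forces E to be
    Archimedean ([polmod_archimedean]).

    The integral of an elementary function does not depend on its
    representation, because two partitions of X have a common refinement
    ([step_sum_le]). The heart of the matter is
    [elementary_integral_below_sup]: if an elementary function phi lies below
    the pointwise supremum of an increasing sequence f_n, then its integral is
    at most any S that bounds the integrals of all elementary functions below
    some f_n. One restricts c phi, with c < 1, to the increasing sets where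
    c phi <= f_n, uses continuity of mu from below, and lets c tend to 1.
    Applied to elementary f_n it identifies the integral of f >= 0 with the
    supremum of the integrals of the elementary functions below f
    ([order_integral_ge0_sup]), a description in which no sequence has to be
    chosen; applied to measurable f_n it is the monotone convergence theorem
    ([order_integral_ge0_monotone_convergence]). Additivity and homogeneity
    are read off from approximating sequences.

    For (1), a subspace of functions that is closed under absolute values is a
    lattice under the pointwise operations, and monotonicity of the integral
    shows that L^1 contains every measurable function dominated by one of its
    elements. In particular a sequence in L^1 that is bounded above in L^1 has
    its pointwise supremum in L^1 ([L1space_pointwise_sup]). This gives
    sigma-Dedekind completeness, and it also shows that countable suprema in
    L^1 are pointwise, which is what turns the order-theoretic hypotheses of
    (2) and (3) into pointwise ones: (2) is then monotone convergence applied
    to u_0 - u_n, and (3) holds because a countable union of null sets is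
    null. *)

Set Implicit Arguments.
Unset Strict Implicit.
Unset Printing Implicit Defensive.

Import Order.TTheory GRing.Theory Num.Theory.
Import numFieldNormedType.Exports.

Local Open Scope classical_set_scope.
Local Open Scope ring_scope.

(** * Partially ordered vector spaces *)

Section porderlmod_theory.
Context {R : realType} {E : porderLmodType R}.
Implicit Types (x y z : E) (r s : R).

Lemma polmod_leD x y z t : x <= y -> z <= t -> x + z <= y + t.
Proof.
move=> xy zt; apply: le_trans (polmod_leD2r z _ _ xy) _.
by rewrite ![y + _]addrC; exact: polmod_leD2r.
Qed.

Lemma polmod_leBrDr x y z : (x <= y - z) = (x + z <= y).
Proof.
apply/idP/idP => h; first by rewrite -[y](subrK z); exact: polmod_leD2r.
by rewrite -[x](addrK z); exact: polmod_leD2r.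
Qed.

Lemma polmod_subr_ge0 x y : (0 <= y - x) = (x <= y).
Proof. by rewrite polmod_leBrDr add0r. Qed.

Lemma polmod_leN2 x y : x <= y -> - y <= - x.
Proof. by move=> xy; rewrite -polmod_subr_ge0 opprK addrC polmod_subr_ge0. Qed.

Lemma polmod_ler_wpZ2l r x y : 0 <= r -> x <= y -> r *: x <= r *: y.
Proof.
move=> r0 xy; rewrite -polmod_subr_ge0 -scalerBr.
by apply: polmod_scale_ge0; rewrite // polmod_subr_ge0.
Qed.

Lemma polmod_ler_wpZ2r r s x : r <= s -> 0 <= x -> r *: x <= s *: x.
Proof.
move=> rs x0; rewrite -polmod_subr_ge0 -scalerBl.
by apply: polmod_scale_ge0; rewrite // subr_ge0.
Qed.

(** The increasing sequence of the - x / (k + 1) is bounded above by 0, and its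
    supremum s satisfies 2 s >= s, so s >= 0, while y - x is an upper bound of
    the sequence. *)
Lemma polmod_archimedean x y : sigma_monotone_complete [set: E] -> 0 <= x ->
  (forall k, (1 - k.+2%:R^-1) *: x <= y) -> x <= y.
Proof.
move=> hE x0 xy.
pose w k : E := - (k.+1%:R^-1 *: x).
have w_nd : nondecreasing_seq w.
  move=> m n mn; apply/polmod_leN2/polmod_ler_wpZ2r => //.
  by rewrite lef_pV2 ?posrE ?ltr0n// ler_nat.
have w0 : ubound (range w) 0.
  move=> _ [k _ <-]; rewrite -[leRHS]oppr0; apply: polmod_leN2.
  by apply: polmod_scale_ge0; rewrite ?invr_ge0.
have [s [[_ sub] slb]] := hE w 0 (fun=> I) w_nd I w0.
(* 2 s is an upper bound of the sequence as well, since w k = 2 w (2 k + 1). *)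
have s0 : 0 <= s.
  rewrite -[0](subrr s) -[leRHS](addrK s); apply: polmod_leD2r.
  apply: slb; split => // _ [k _ <-].
  have -> : w k = w (k + k).+1 + w (k + k).+1.
    rewrite /w -opprD -scalerDl; congr (- (_ *: _)).
    by rewrite -addnS -addSn addnn -muln2 natrM invfM -splitr.
  by apply: polmod_leD; apply: sub; exists (k + k).+1.
rewrite -polmod_subr_ge0; apply: le_trans s0 _; apply: slb; split => //.
(* The hypothesis speaks of denominators k + 2 only, hence the shift by one. *)
move=> _ [k _ <-]; apply: (@le_trans _ _ (w k.+1)); first exact: w_nd.
by have := xy k; rewrite polmod_leBrDr scalerBl scale1r addrC.
Qed.

End porderlmod_theory.

(** * The extended space *)

Section infext_theory.
Context {R : realType} {E : porderLmodType R}.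
Implicit Types (x y z : infext E) (r s : R) (u v : nat -> infext E).

Lemma ext_leFin (a b : E) : (Fin a <= Fin b) = (a <= b).
Proof. by []. Qed.

Lemma ext_le_Infty x : x <= Infty.
Proof. by case: x. Qed.

Lemma ext_addFin (a b : E) : Fin a + Fin b = Fin (a + b).
Proof. by []. Qed.

Lemma ext_leFinP x (e : E) : x <= Fin e -> exists2 a, x = Fin a & a <= e.
Proof. by case: x => // a ae; exists a. Qed.

Lemma ext_leD x y z t : x <= y -> z <= t -> x + z <= y + t.
Proof.
case: y t => [b|] [d|]; rewrite ?ext_le_Infty//.
by case: x => // a; case: z => // c; exact: polmod_leD.
Qed.

Lemma ext_addr_ge0 x y : Fin 0 <= x -> Fin 0 <= y -> Fin 0 <= x + y.
Proof. by move=> x0 y0; rewrite -[Fin 0]addr0; exact: ext_leD. Qed.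

Lemma ext_leDl x y : Fin 0 <= y -> x <= x + y.
Proof. by move=> y0; rewrite -[leLHS]addr0; exact: ext_leD. Qed.

Lemma ext_scale_ge0 r x : 0 <= r -> Fin 0 <= x -> Fin 0 <= ext_scale r x.
Proof.
move=> r0; case: x => [a a0|_] /=; first exact: polmod_scale_ge0.
by case: ifP.
Qed.

Lemma ext_scale0l x : ext_scale 0 x = 0.
Proof. by case: x => [a|] /=; rewrite ?scale0r// eqxx. Qed.

Lemma ext_scale0r r : ext_scale r 0 = 0 :> infext E.
Proof. by rewrite /= scaler0. Qed.

Lemma ext_scale1 x : ext_scale 1 x = x.
Proof. by case: x => [a|] /=; rewrite ?scale1r// oner_eq0. Qed.

Lemma ext_scaleDr r x y : ext_scale r (x + y) = ext_scale r x + ext_scale r y.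
Proof.
case: x y => [a|] [b|] /=; rewrite ?ext_addFin ?scalerDr//.
all: have [r0|//] := eqVneq r 0; rewrite ?r0 ?scale0r ext_addFin addr0//.
Qed.

Lemma ext_scaleDl r s x : 0 <= r -> 0 <= s ->
  ext_scale (r + s) x = ext_scale r x + ext_scale s x.
Proof.
move=> r0 s0; case: x => [a|] /=; first by rewrite scalerDl.
rewrite paddr_eq0//; case: eqP => _; case: eqP => _ //=.
by rewrite ext_addFin addr0.
Qed.

Lemma ext_scaleA r s x : ext_scale r (ext_scale s x) = ext_scale (r * s) x.
Proof.
case: x => [a|] /=; first by rewrite scalerA.
by rewrite mulf_eq0 orbC; case: (s == 0); rewrite /= ?scaler0.
Qed.

Lemma ext_scaleInfty r : 0 < r -> ext_scale r Infty = Infty :> infext E.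
Proof. by move=> r0; rewrite /= gt_eqF. Qed.

Lemma ext_ler_wpZ2l r x y : 0 <= r -> x <= y -> ext_scale r x <= ext_scale r y.
Proof.
rewrite le_eqVlt => /predU1P[<-|r0]; first by rewrite !ext_scale0l.
case: y => [b|]; last by move=> _; rewrite ext_scaleInfty// ext_le_Infty.
by case: x => // a; apply/polmod_ler_wpZ2l/ltW.
Qed.

Lemma ext_ler_wpZ2r r s x : 0 <= r -> r <= s -> Fin 0 <= x ->
  ext_scale r x <= ext_scale s x.
Proof.
move=> r0 rs x0; rewrite -(subrK r s) addrC ext_scaleDl ?subr_ge0//.
by apply/ext_leDl/ext_scale_ge0; rewrite ?subr_ge0.
Qed.

Lemma ext_scale_sum (I : Type) (l : seq I) (P : pred I) (F : I -> infext E) r :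
  ext_scale r (\sum_(i <- l | P i) F i) = \sum_(i <- l | P i) ext_scale r (F i).
Proof.
by apply: (big_morph (ext_scale r) (ext_scaleDr r)); exact: ext_scale0r.
Qed.

Lemma ext_sumr_ge0 (I : Type) (l : seq I) (P : pred I) (F : I -> infext E) :
  (forall i, P i -> Fin 0 <= F i) -> Fin 0 <= \sum_(i <- l | P i) F i.
Proof.
by move=> F0; apply: (big_ind (fun x => Fin 0 <= x)) => //; exact: ext_addr_ge0.
Qed.

Lemma ext_ler_sum (I : Type) (l : seq I) (P : pred I) (F G : I -> infext E) :
  (forall i, P i -> F i <= G i) ->
  \sum_(i <- l | P i) F i <= \sum_(i <- l | P i) G i.
Proof.
move=> FG; apply: (big_ind2 (fun x y => x <= y)) => //.
by move=> x1 x2 y1 y2; exact: ext_leD.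
Qed.

(** The factors 1 - 1 / (k + 2) are positive for every k: the factor 0 would
    send the infinite element to 0 and spoil the case x = Infty. *)
Lemma ext_archimedean x y : sigma_monotone_complete [set: E] -> Fin 0 <= x ->
  (forall k, ext_scale (1 - k.+2%:R^-1) x <= y) -> x <= y.
Proof.
move=> hE; case: y => [b|]; last by rewrite ext_le_Infty.
case: x => [a a0 h|_ /(_ 0)] /=; first exact: polmod_archimedean a0 h.
by rewrite subr_eq0 eq_sym invr_eq1 pnatr_eq1.
Qed.

(** Either the sequence is bounded by an element of E, and then it takes its
    values in E, whose completeness applies; or the only upper bound is
    infinity. *)
Lemma ext_sup_exists u : sigma_monotone_complete [set: E] ->
  nondecreasing_seq u -> exists x, supremums (range u) x.
Proof.
move=> hE u_nd.
have [[e ue]|unbounded] := pselect (exists e, ubound (range u) (Fin e)).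
  have uE n : exists a, u n = Fin a.
    by have [|a -> _] := @ext_leFinP (u n) e; [apply: ue; exists n|exists a].
  have {uE} [a uE] := choice uE.
  have a_nd : nondecreasing_seq a.
    by move=> m n /u_nd; rewrite !uE.
  have ae : ubound (range a) e.
    by move=> _ [n _ <-]; rewrite -ext_leFin -uE; apply: ue; exists n.
  have [s [[_ sub] slb]] := hE a e (fun=> I) a_nd I ae.
  exists (Fin s); split.
    by move=> _ [n _ <-]; rewrite uE ext_leFin; apply: sub; exists n.
  move=> [b ub|_]; last exact: ext_le_Infty.
  rewrite ext_leFin; apply: slb; split => // _ [n _ <-].
  by rewrite -ext_leFin -uE; apply: ub; exists n.
exists Infty; split; first by move=> y _; exact: ext_le_Infty.
by move=> [b ub|//]; exfalso; apply: unbounded; exists b.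
Qed.

(** Monotonicity bounds u_m + v_n, for independent m and n, by every upper
    bound of the diagonal sums; the supremum can then be taken in one variable
    at a time, the other term being moved to the right-hand side. *)
Lemma ext_supD u v x y : nondecreasing_seq u -> nondecreasing_seq v ->
  supremums (range u) x -> supremums (range v) y ->
  supremums (range (fun n => u n + v n)) (x + y).
Proof.
move=> u_nd v_nd [ux lx] [vy ly]; split.
  by move=> _ [n _ <-]; apply: ext_leD; [apply: ux|apply: vy]; exists n.
move=> [e|_]; last exact: ext_le_Infty.
move=> uve.
have uv_le m n : u m + v n <= Fin e.
  apply: (@le_trans _ _ (u (maxn m n) + v (maxn m n))).
    by apply: ext_leD; [apply: u_nd|apply: v_nd]; rewrite ?leq_maxl ?leq_maxr.
  by apply: uve; exists (maxn m n).
have vFin n : exists b, v n = Fin b.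
  by move: (uv_le 0 n); case: (u 0) => // a; case: (v n) => // b; exists b.
have [b vE] := choice vFin.
have xb n : x <= Fin (e - b n).
  apply: lx => _ [m _ <-]; move: (uv_le m n); rewrite vE.
  by case: (u m) => // a; rewrite !ext_leFin polmod_leBrDr.
have [a xE _] := ext_leFinP (xb 0).
have ya : y <= Fin (e - a).
  apply: ly => _ [n _ <-]; rewrite vE ext_leFin polmod_leBrDr addrC.
  by rewrite -polmod_leBrDr -ext_leFin -xE.
have [c yE] := ext_leFinP ya.
by rewrite xE yE ext_leFin polmod_leBrDr addrC.
Qed.

Lemma ext_supZ r u x : 0 <= r -> supremums (range u) x ->
  supremums (range (fun n => ext_scale r (u n))) (ext_scale r x).
Proof.
rewrite le_eqVlt => /predU1P[<- _|r0 [ux lx]].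
  rewrite (_ : (fun _ => _) = (fun=> 0)); last first.
    by apply/funext => n; rewrite ext_scale0l.
  rewrite ext_scale0l (_ : range _ = [set 0]) ?supremums1//.
  by apply/seteqP; split => [_ [n _ <-]//|_ ->]; exists 0.
split.
  by move=> _ [n _ <-]; apply: ext_ler_wpZ2l (ltW r0) _; apply: ux; exists n.
move=> y uy; rewrite -[y]ext_scale1 -(mulfV (lt0r_neq0 r0)) -ext_scaleA.
apply: ext_ler_wpZ2l (ltW r0) _; apply: lx => _ [n _ <-].
rewrite -[u n]ext_scale1 -(mulVf (lt0r_neq0 r0)) -ext_scaleA.
apply: ext_ler_wpZ2l; first by rewrite invr_ge0 ltW.
by apply: uy; exists n.
Qed.

Lemma ext_sup_sum (I : Type) (l : seq I) (u : I -> nat -> infext E)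
    (x : I -> infext E) :
  (forall i, nondecreasing_seq (u i)) ->
  (forall i, supremums (range (u i)) (x i)) ->
  supremums (range (fun n => \sum_(i <- l) u i n)) (\sum_(i <- l) x i).
Proof.
move=> u_nd ux; elim: l => [|i l IH].
  rewrite (_ : (fun _ => _) = (fun=> 0)); last first.
    by apply/funext => n; rewrite big_nil.
  rewrite big_nil (_ : range _ = [set 0]) ?supremums1//.
  by apply/seteqP; split => [_ [n _ <-]//|_ ->]; exists 0.
rewrite big_cons (_ : (fun _ => _) = fun n => u i n + \sum_(j <- l) u j n).
  apply: ext_supD => // m n mn; apply: ext_ler_sum => j _; exact: u_nd.
by apply/funext => n; rewrite big_cons.
Qed.

Lemma sup_eventually_constant {d} {T : porderType d} (u : nat -> T) N :
  nondecreasing_seq u -> (forall n, (N <= n)%N -> u n = u N) ->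
  supremums (range u) (u N).
Proof.
move=> u_nd uN; split; last by move=> y; apply; exists N.
move=> _ [n _ <-]; have [nN|/ltnW Nn] := leqP n N; first exact: u_nd.
by rewrite uN.
Qed.

End infext_theory.

(** * Measurable sets and functions *)

Section sigma_algebra_closure.
Context {X : Type} {Omega : set (set X)}.
Hypothesis hOmega : sigma_algebra [set: X] Omega.

Lemma sigma_algebra_set0 : Omega set0.
Proof. by case: hOmega. Qed.

Lemma sigma_algebra_setC (A : set X) : Omega A -> Omega (~` A).
Proof. by case: hOmega => _ hC _ /hC; rewrite setTD. Qed.

Lemma sigma_algebra_setT : Omega setT.
Proof. by rewrite -setC0; apply/sigma_algebra_setC/sigma_algebra_set0. Qed.

Lemma sigma_algebra_bigcupT (T : countType) (F : T -> set X) :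
  (forall i, Omega (F i)) -> Omega (\bigcup_i F i).
Proof.
move=> OF; pose G n := if unpickle n is Some i then F i else set0.
have -> : \bigcup_i F i = \bigcup_n G n.
  apply/seteqP; split => x [i _].
    by exists (pickle i); rewrite // /G pickleK.
  by rewrite /G; case: unpickle => // j Fjx; exists j.
by case: hOmega => O0 _; apply => n; rewrite /G; case: unpickle.
Qed.

Lemma sigma_algebra_setU (A B : set X) : Omega A -> Omega B -> Omega (A `|` B).
Proof.
move=> OA OB; rewrite (_ : A `|` B = \bigcup_(b : bool) if b then A else B).
  by apply: sigma_algebra_bigcupT; case.
apply/seteqP; split => [x [Ax|Bx]|x [[] _ h]].
- by exists true.
- by exists false.
- by left.
- by right.
Qed.

Lemma sigma_algebra_setI (A B : set X) : Omega A -> Omega B -> Omega (A `&` B).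
Proof.
move=> OA OB; rewrite -[A `&` B]setCK setCI; apply: sigma_algebra_setC.
by apply: sigma_algebra_setU; apply: sigma_algebra_setC.
Qed.

Lemma sigma_algebra_setD (A B : set X) : Omega A -> Omega B -> Omega (A `\` B).
Proof.
move=> OA OB; rewrite setDE; apply: sigma_algebra_setI => //.
exact: sigma_algebra_setC.
Qed.

End sigma_algebra_closure.

Section measurable_functions.
Context {R : realType} {X : Type} {Omega : set (set X)}.
Hypothesis hOmega : sigma_algebra [set: X] Omega.
Implicit Types f g : X -> R.

Lemma measurable_wrt_gt f a : measurable_wrt Omega f -> Omega [set x | a < f x].
Proof.
move=> mf; have := mf `]a, +oo[%classic (measurable_itv _).
rewrite (_ : f @^-1` _ = [set x | a < f x])//.
by apply/seteqP; split => x /=; rewrite in_itv/= andbT.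
Qed.

(** The sets with measurable preimage form a sigma-algebra, and the half-open
    intervals that generate the Borel sets are differences of rays. *)
Lemma measurable_wrt_rays f :
  (forall a, Omega [set x | a < f x]) -> measurable_wrt Omega f.
Proof.
move=> Of; apply: smallest_sub => [|_ [[a b] _ <-]] /=.
  split=> [|A OA|F OF].
  - by rewrite preimage_set0; exact: sigma_algebra_set0.
  - by rewrite setTD preimage_setC; exact: sigma_algebra_setC.
  - by rewrite preimage_bigcup; exact: sigma_algebra_bigcupT.
rewrite (_ : f @^-1` _ = [set x | a < f x] `\` [set x | b < f x]).
  by apply: sigma_algebra_setD => //.
apply/seteqP; split => x /=; rewrite in_itv/= leNgt.
  by move=> /andP[-> /negP].
by move=> [-> /negP].
Qed.

Lemma measurable_wrt_comp (h : R -> R) f : measurable_fun setT h ->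
  measurable_wrt Omega f -> measurable_wrt Omega (h \o f).
Proof.
move=> mh mf B mB; rewrite comp_preimage; apply: mf.
by rewrite -[_ @^-1` _]setTI; exact: mh.
Qed.

Lemma measurable_wrt_norm f :
  measurable_wrt Omega f -> measurable_wrt Omega (fun x => `|f x|).
Proof. by apply: measurable_wrt_comp; exact: normr_measurable. Qed.

Lemma measurable_wrtZ r f :
  measurable_wrt Omega f -> measurable_wrt Omega (fun x => r * f x).
Proof. by apply: (@measurable_wrt_comp ( *%R r)); exact: mulrl_measurable. Qed.

Lemma measurable_wrtN f :
  measurable_wrt Omega f -> measurable_wrt Omega (fun x => - f x).
Proof. by apply: (@measurable_wrt_comp -%R); exact: oppr_measurable. Qed.

Lemma measurable_wrt_cst (r : R) : measurable_wrt Omega (fun=> r : R).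
Proof.
apply: measurable_wrt_rays => a; have [ar|ra] := ltP a r.
  rewrite (_ : [set _ | _] = setT); first exact: sigma_algebra_setT.
  by apply/seteqP; split.
rewrite (_ : [set _ | _] = set0); first exact: sigma_algebra_set0.
by apply/seteqP; split.
Qed.

Lemma measurable_wrtD f g : measurable_wrt Omega f -> measurable_wrt Omega g ->
  measurable_wrt Omega (fun x => f x + g x).
Proof.
move=> mf mg; apply: measurable_wrt_rays => a.
rewrite (_ : [set _ | _] = \bigcup_(q in [set: rat])
    ([set x | ratr q < f x] `&` [set x | a - ratr q < g x])).
  apply: sigma_algebra_bigcupT => // q.
  by apply: sigma_algebra_setI => //; exact: measurable_wrt_gt.
apply/seteqP; split => x /=.
  rewrite -ltrBlDr => /rat_in_itvoo[q]; rewrite in_itv/= => /andP[q1 q2].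
  by exists q => //; split => //=; rewrite ltrBlDr addrC -ltrBlDr.
by move=> [q _ [/= q1 q2]]; rewrite -(subrK (ratr q) a) addrC ltrD.
Qed.

Lemma measurable_wrtB f g : measurable_wrt Omega f -> measurable_wrt Omega g ->
  measurable_wrt Omega (fun x => f x - g x).
Proof.
by move=> mf mg; apply: (measurable_wrtD mf); exact: measurable_wrtN.
Qed.

Lemma measurable_wrt_sup (T : countType) (u : T -> X -> R) f :
  (forall n, measurable_wrt Omega (u n)) ->
  (forall x, supremums (range (u ^~ x)) (f x)) -> measurable_wrt Omega f.
Proof.
move=> mu uf; apply: measurable_wrt_rays => a.
rewrite (_ : [set _ | _] = \bigcup_n [set x | a < u n x]).
  by apply: sigma_algebra_bigcupT => // n; exact: measurable_wrt_gt.
apply/seteqP; split => x /= => [afx|[n _ /= anx]].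
  apply: contrapT => nau; move: afx; rewrite ltNge => /negP; apply.
  apply: (uf x).2 => _ [n _ <-]; rewrite leNgt; apply/negP => aun.
  by apply: nau; exists n.
by apply: lt_le_trans anx _; apply: (uf x).1; exists n.
Qed.

Lemma measurable_wrt_indic (D : set X) :
  Omega D -> measurable_wrt Omega (\1_D : X -> R).
Proof.
move=> OD; apply: measurable_wrt_rays => a.
have [a1|a1] := leP 1 a.
  rewrite (_ : [set _ | _] = set0); first exact: sigma_algebra_set0.
  apply/seteqP; split => x //=; rewrite ltNge indicE => /negP; apply.
  by apply: le_trans a1; case: (_ \in _).
have [a0|a0] := leP 0 a.
  rewrite (_ : [set _ | _] = D)//; apply/seteqP; split => x /=; rewrite indicE.
    by case: (boolP (x \in D)) => [/set_mem//|_]; rewrite ltNge a0.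
  by move=> /mem_set ->.
rewrite (_ : [set _ | _] = setT); first exact: sigma_algebra_setT.
by apply/seteqP; split => x //= _; apply: lt_le_trans a0 _; rewrite indicE.
Qed.

Lemma measurable_wrt_sum (I : Type) (l : seq I) (F : I -> X -> R) :
  (forall i, measurable_wrt Omega (F i)) ->
  measurable_wrt Omega (fun x => \sum_(i <- l) F i x).
Proof.
move=> mF; elim: l => [|i l IH].
  rewrite (_ : (fun _ => _) = fun=> 0); first exact: measurable_wrt_cst.
  by apply/funext => x; rewrite big_nil.
rewrite (_ : (fun _ => _) = fun x => F i x + \sum_(j <- l) F j x).
  exact: measurable_wrtD.
by apply/funext => x; rewrite big_cons.
Qed.

Lemma measurable_wrt_le f g :
  measurable_wrt Omega f -> measurable_wrt Omega g ->
  Omega [set x | f x <= g x].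
Proof.
move=> mf mg; rewrite (_ : [set _ | _] = ~` [set x | 0 < f x - g x]).
  apply: sigma_algebra_setC => //; apply: measurable_wrt_gt.
  exact: measurable_wrtB.
by apply/seteqP; split => x /=; rewrite subr_gt0 leNgt => /negP.
Qed.

End measurable_functions.

(** * Measures with values in the extended cone *)

Section measures.
Context {R : realType} {E : porderLmodType R} {X : Type}.
Context {Omega : set (set X)} {mu : set X -> infext E}.
Hypotheses (hOmega : sigma_algebra [set: X] Omega) (hmu : is_measure Omega mu).

(** Additivity is an instance of countable additivity, for the sequence A, B,
    set0, set0, ...: its partial sums are constant from index 1 on. *)
Lemma measure_setU (A B : set X) : Omega A -> Omega B -> A `&` B = set0 ->
  mu (A `|` B) = mu A + mu B.
Proof.
move=> OA OB AB.
pose D n := match n with 0 => A | 1 => B | _ => set0 end.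
have OD n : Omega (D n).
  by case: n => [//|[//|n]]; exact: sigma_algebra_set0.
have tD : trivIset setT D.
  apply/trivIsetP => -[|[|i]] [|[|j]] //= _ _ _; rewrite ?setI0 ?set0I//.
  by rewrite setIC.
have DE : \bigcup_n D n = A `|` B.
  apply/seteqP; split => [x [[|[|n]] _ Dx]|x [Ax|Bx]] //; [by left|by right|..].
    by exists 0.
  by exists 1.
have OAB : Omega (A `|` B) by exact: sigma_algebra_setU.
have := is_measure_bigcup hmu OD tD; rewrite DE => /(_ OAB) sD.
apply: is_subset1_supremums sD _.
pose u N := \sum_(n < N.+1) mu (D n).
have u1 : u 1 = mu A + mu B by rewrite /u !big_ord_recr big_ord0 /= add0r.
have uS n : u n.+1 = u n + mu (D n.+1) by rewrite /u big_ord_recr.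
have uc n : u n.+1 = u 1.
  by elim: n => // n IH; rewrite uS IH /= (is_measure0 hmu); exact: addr0.
rewrite -u1; apply: sup_eventually_constant => [|[|n] _ //]; last exact: uc.
apply/nondecreasing_seqP => n; rewrite -/(u _) -/(u _) uS.
exact/ext_leDl/(is_measure_ge0 hmu).
Qed.

Lemma measure_le (A B : set X) : Omega A -> Omega B -> A `<=` B -> mu A <= mu B.
Proof.
move=> OA OB AB; rewrite -(setDUK AB) measure_setU//.
- by apply/ext_leDl/(is_measure_ge0 hmu)/sigma_algebra_setD.
- exact: sigma_algebra_setD.
- by rewrite setDIK.
Qed.

Lemma measure_bigcup_fin (T : finType) (D : T -> set X) :
  (forall i, Omega (D i)) -> trivIset setT D ->
  mu (\bigcup_i D i) = \sum_i mu (D i).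
Proof.
move=> OD tD.
have Obig (l : seq T) : Omega (\big[setU/set0]_(i <- l) D i).
  apply: (big_ind Omega) => //; first exact: sigma_algebra_set0.
  exact: sigma_algebra_setU.
suff H (l : seq T) : uniq l ->
    mu (\big[setU/set0]_(i <- l) D i) = \sum_(i <- l) mu (D i).
  rewrite -(H _ (index_enum_uniq T)) -bigcup_seq; congr mu.
  by apply/seteqP; split => x [i _ Dx]; exists i => //=; rewrite mem_index_enum.
elim: l => [|i l IH] /=; first by rewrite !big_nil (is_measure0 hmu).
move=> /andP[il ul]; rewrite !big_cons measure_setU ?IH//.
rewrite -bigcup_seq; apply/seteqP; split => x // [Dix [j /= jl Djx]].
have ij : i = j by apply: tD => //; exists x.
by rewrite ij jl in il.
Qed.

Lemma measure_partition (T : finType) (D : T -> set X) (A : set X) :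
  (forall i, Omega (D i)) -> trivIset setT D -> \bigcup_i D i = setT ->
  Omega A -> mu A = \sum_i mu (A `&` D i).
Proof.
move=> OD tD cD OA; rewrite -measure_bigcup_fin.
- by rewrite -setI_bigcupr cD setIT.
- by move=> i; exact: sigma_algebra_setI.
- exact: trivIset_setIl.
Qed.

(** The successive differences of the A n are disjoint, and their partial sums
    telescope to mu (A n). *)
Lemma measure_cvg_below (A : nat -> set X) :
  (forall n, Omega (A n)) -> (forall m n, (m <= n)%N -> A m `<=` A n) ->
  supremums (range (mu \o A)) (mu (\bigcup_n A n)).
Proof.
move=> OA A_nd.
have A_nd' : nondecreasing_seq A by move=> m n /A_nd /subsetPset.
have OD n : Omega (seqD A n).
  by case: n => [|n] //=; exact: sigma_algebra_setD.
have := is_measure_bigcup hmu OD (trivIset_seqD A_nd').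
rewrite eq_bigcup_seqD => /(_ (sigma_algebra_bigcupT hOmega OA)).
rewrite (_ : (fun _ => _) = mu \o A)//; apply/funext => n /=.
elim: n => [|n IH]; first by rewrite big_ord1.
rewrite big_ord_recr IH /= -measure_setU ?setDUK ?setDIK//.
  by apply: A_nd.
exact: sigma_algebra_setD.
Qed.

Lemma null_setU (A B : set X) : Omega A -> Omega B ->
  mu A = Fin 0 -> mu B = Fin 0 -> mu (A `|` B) = Fin 0.
Proof.
move=> OA OB A0 B0; rewrite -(setDUK (@subsetUl _ A B)) setDUl setDv set0U.
have OBA : Omega (B `\` A) by exact: sigma_algebra_setD.
rewrite measure_setU ?setDIK// A0 (_ : mu (B `\` A) = Fin 0).
  exact: addr0.
apply/le_anti/andP; split; last exact: (is_measure_ge0 hmu).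
by rewrite -B0; apply: measure_le => //; exact: subDsetl.
Qed.

Lemma null_bigcup (A : nat -> set X) : (forall n, Omega (A n)) ->
  (forall n, mu (A n) = Fin 0) -> mu (\bigcup_n A n) = Fin 0.
Proof.
move=> OA A0.
pose B n := \big[setU/set0]_(i < n) A i.
have BS n : B n.+1 = B n `|` A n by rewrite /B big_ord_recr.
have OB n : Omega (B n).
  elim: n => [|n IH]; first by rewrite /B big_ord0; exact: sigma_algebra_set0.
  by rewrite BS; exact: sigma_algebra_setU.
have B0 n : mu (B n) = Fin 0.
  elim: n => [|n IH]; first by rewrite /B big_ord0 (is_measure0 hmu).
  by rewrite BS; exact: null_setU.
have B_nd m n : (m <= n)%N -> B m `<=` B n.
  move=> mn; rewrite -(subnK mn); elim: (n - m)%N => // k IH.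
  by rewrite addSn BS; apply: subset_trans IH _; exact: subsetUl.
have BE : \bigcup_n B n = \bigcup_n A n.
  apply/seteqP; split => x [n _]; last by exists n.+1 => //; rewrite BS; right.
  by rewrite /B -bigcup_mkord => -[i _ Ax]; exists i.
have [ub lb] := measure_cvg_below OB B_nd.
rewrite -BE; apply/le_anti/andP; split.
  by apply: lb => _ [n _ <-] /=; rewrite B0.
by rewrite -(B0 0); apply: ub; exists 0.
Qed.

End measures.

Lemma cvg_EFin_sup {R : realType} (u : R^nat) (l : R) : nondecreasing_seq u ->
  (u n)%:E @[n --> \oo] --> l%:E <-> supremums (range u) l.
Proof.
move=> u_nd; split=> [/fine_cvgP[_ ul]|ul].
  have cu : cvgn u by apply/cvg_ex; exists l.
  have lE : limn u = l by exact/cvg_lim.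
  split=> [_ [n _ <-]|y uy]; first by rewrite -lE; exact: nondecreasing_cvgn_le.
  by rewrite -lE; apply: limr_le => //; near=> n; apply: uy; exists n.
have hu : has_ubound (range u) by exists l; exact: ul.1.
apply: cvg_EFin; first by near=> n.
have -> : l = sup (range u).
  apply: is_subset1_supremums ul _; split; first exact: ub_le_sup.
  by move=> y uy; apply: ge_sup => //; exists (u 0), 0.
exact: nondecreasing_cvgn.
Unshelve. all: end_near. Qed.

(** * Elementary functions *)

Section elementary_functions.
Context {R : realType} {E : porderLmodType R} {X : Type}.
Context {Omega : set (set X)} {mu : set X -> infext E}.
Hypotheses (hOmega : sigma_algebra [set: X] Omega) (hmu : is_measure Omega mu).
Implicit Types (phi psi : X -> R).

(** Unlike in [elementary_repr], the sets cover X, so that a value is read off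
    from any index i with D i x, and the index type is any finite type, so that
    refinements are indexed by products. *)
Definition step_partition (T : finType) phi (r : T -> R) (D : T -> set X) :=
  [/\ forall i, 0 <= r i, forall i, Omega (D i), trivIset setT D,
      \bigcup_i D i = setT & forall i x, D i x -> phi x = r i].

Local Notation step_sum r D := (\sum_i ext_scale (r i) (mu (D i))).

(** Both sums are refined to the sets D i `&` C j. Where such a set has a
    point x, the two coefficients are phi x <= psi x; where it is empty, its
    measure is 0. *)
Lemma step_sum_le (T T' : finType) phi psi (r : T -> R) (s : T' -> R)
    (D : T -> set X) (C : T' -> set X) :
  step_partition phi r D -> step_partition psi s C ->
  (forall x, phi x <= psi x) -> step_sum r D <= step_sum s C.
Proof.
move=> [r0 OD tD cD phiE] [s0 OC tC cC psiE] phipsi.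
have OI i j : Omega (D i `&` C j) by exact: sigma_algebra_setI.
have -> : step_sum r D = \sum_i \sum_j ext_scale (r i) (mu (D i `&` C j)).
  apply: eq_bigr => i _; rewrite -ext_scale_sum.
  by rewrite -(measure_partition hOmega hmu OC).
have -> : step_sum s C = \sum_i \sum_j ext_scale (s j) (mu (D i `&` C j)).
  rewrite exchange_big; apply: eq_bigr => j _; rewrite -ext_scale_sum.
  congr ext_scale; rewrite (measure_partition hOmega hmu OD)//.
  by apply: eq_bigr => i _; rewrite setIC.
apply: ext_ler_sum => i _; apply: ext_ler_sum => j _.
have [->|/set0P[x [Dx Cx]]] := eqVneq (D i `&` C j) set0.
  by rewrite (is_measure0 hmu) !ext_scale0r.
apply: ext_ler_wpZ2r => //; last exact: (is_measure_ge0 hmu).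
by rewrite -(phiE _ _ Dx) -(psiE _ _ Cx).
Qed.

Lemma sum_indic_partition (T : finType) (r : T -> R) (D : T -> set X) i x :
  trivIset setT D -> D i x -> \sum_j r j * \1_(D j) x = r i.
Proof.
move=> tD Dx; rewrite (bigD1 i)//= big1 => [|j ji].
  by rewrite indicE mem_set// mulr1 addr0.
rewrite indicE memNset ?mulr0// => Djx; move: ji; rewrite (tD j i)// ?eqxx//.
by exists x.
Qed.

(** The complement of the union of the D i is added as the piece None, with
    coefficient 0. *)
Lemma step_partition_of_repr phi n (r : 'I_n -> R) (D : 'I_n -> set X) :
  elementary_repr Omega phi r D ->
  step_partition phi (oapp r 0) (oapp D (~` \bigcup_i D i)).
Proof.
move=> [r0 OD tD phiE].
have OU : Omega (\bigcup_i D i) by exact: sigma_algebra_bigcupT.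
split.
- by case=> [i|] /=.
- by case=> [i|] //=; exact: sigma_algebra_setC.
- move=> [i|] [j|] _ _ [x []] //=.
  + by move=> Di Dj; congr Some; apply: tD => //; exists x.
  + by move=> Di; case; exists i.
  + by move=> + Dj; case; exists j.
- apply/seteqP; split => x // _.
  have [[i _ Dx]|nDx] := pselect ((\bigcup_i D i) x).
    by exists (Some i).
  by exists None.
- move=> [i|] x /= Dx; rewrite phiE; first exact: sum_indic_partition.
  apply: big1 => i _; rewrite indicE memNset ?mulr0// => Di.
  by apply: Dx; exists i.
Qed.

Lemma step_sum_complement n (r : 'I_n -> R) (D : 'I_n -> set X) (C : set X) :
  step_sum (oapp r 0) (oapp D C) = step_sum r D.
Proof.
rewrite (bigD1 None)//= ext_scale0l add0r (reindex_omap Some id) => [|[]//].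
by apply: eq_bigl => i; rewrite /= eqxx.
Qed.

Lemma repr_of_step_partition (T : finType) phi (r : T -> R) (D : T -> set X) :
  step_partition phi r D ->
  elementary_repr Omega phi (r \o @enum_val T T) (D \o @enum_val T T).
Proof.
move=> [r0 OD tD cD phiE]; split=> [i|i|i j _ _ Dij|x] /=.
- exact: r0.
- exact: OD.
- by apply: enum_val_inj; apply: tD.
have [i _ Dx] : (\bigcup_i D i) x by rewrite cD.
rewrite (phiE _ _ Dx) -(sum_indic_partition r tD Dx).
by rewrite (reindex _ (onW_bij _ (enum_val_bij T))).
Qed.

Lemma step_partition_elementary (T : finType) phi (r : T -> R)
    (D : T -> set X) :
  step_partition phi r D -> elementary Omega phi.
Proof.
move=> /repr_of_step_partition phiE.
by exists #|T|, (r \o enum_val), (D \o enum_val).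
Qed.

Lemma elementary_integralE (T : finType) phi (r : T -> R) (D : T -> set X) :
  step_partition phi r D -> elementary_integral Omega mu phi = step_sum r D.
Proof.
move=> pD; apply: xget_unique; last first.
  move=> _ [n [s [C [/step_partition_of_repr pC ->]]]].
  have le x : phi x <= phi x by [].
  rewrite -(step_sum_complement s C (~` \bigcup_i C i)).
  apply/le_anti/andP; split; first exact: step_sum_le pC pD le.
  exact: step_sum_le pD pC le.
exists #|T|, (r \o enum_val), (D \o enum_val).
split; first exact: repr_of_step_partition.
by rewrite (reindex _ (onW_bij _ (enum_val_bij T))).
Qed.

Lemma elementaryP phi : elementary Omega phi ->
  exists (T : finType) (r : T -> R) (D : T -> set X), step_partition phi r D.
Proof.
move=> [n [r [D /step_partition_of_repr pD]]].
by exists (option 'I_n), (oapp r 0), (oapp D (~` \bigcup_i D i)).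
Qed.

Lemma elementary_common phi psi :
  elementary Omega phi -> elementary Omega psi ->
  exists (T : finType) (r s : T -> R) (D : T -> set X),
    step_partition phi r D /\ step_partition psi s D.
Proof.
move=> /elementaryP[T [r [D [r0 OD tD cD phiE]]]].
move=> /elementaryP[T' [s [C [s0 OC tC cC psiE]]]].
have OI (k : T * T') : Omega (D k.1 `&` C k.2) by exact: sigma_algebra_setI.
have tI : trivIset setT (fun k : T * T' => D k.1 `&` C k.2).
  move=> [i j] [i' j'] _ _ [x [[/= Di Cj] [Di' Cj']]].
  by congr (_, _); [apply: tD => //; exists x|apply: tC => //; exists x].
have cI : \bigcup_(k : T * T') (D k.1 `&` C k.2) = setT.
  apply/seteqP; split => // x _.
  have [i _ Dx] : (\bigcup_i D i) x by rewrite cD.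
  have [j _ Cx] : (\bigcup_i C i) x by rewrite cC.
  by exists (i, j).
exists (T * T')%type, (r \o fst), (s \o snd), (fun k => D k.1 `&` C k.2).
by split; split => //= k x [Dx Cx]; [exact: phiE|exact: psiE].
Qed.

Lemma elementary_ge0 phi x : elementary Omega phi -> 0 <= phi x.
Proof.
move=> /elementaryP[T [r [D [r0 _ _ cD phiE]]]].
by have [i _ /phiE->] : (\bigcup_i D i) x by rewrite cD.
Qed.

Lemma elementary_measurable phi :
  elementary Omega phi -> measurable_wrt Omega phi.
Proof.
move=> [n [r [D [_ OD _ phiE]]]].
rewrite (_ : phi = fun x => \sum_(i < n) r i * \1_(D i) x); last exact/funext.
apply: measurable_wrt_sum => // i; apply: measurable_wrtZ.
exact: measurable_wrt_indic.
Qed.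

Lemma elementary_integral_ge0 phi :
  elementary Omega phi -> Fin 0 <= elementary_integral Omega mu phi.
Proof.
move=> /elementaryP[T [r [D pD]]]; rewrite (elementary_integralE pD).
case: pD => r0 OD _ _ _; apply: ext_sumr_ge0 => i _.
by apply: ext_scale_ge0 => //; exact: (is_measure_ge0 hmu).
Qed.

Lemma elementary_integral_le phi psi :
  elementary Omega phi -> elementary Omega psi -> (forall x, phi x <= psi x) ->
  elementary_integral Omega mu phi <= elementary_integral Omega mu psi.
Proof.
move=> /elementaryP[T [r [D pD]]] /elementaryP[T' [s [C pC]]] le.
rewrite (elementary_integralE pD) (elementary_integralE pC).
exact: step_sum_le le.
Qed.

Lemma elementaryD phi psi : elementary Omega phi -> elementary Omega psi ->
  elementary Omega (fun x => phi x + psi x) /\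
  elementary_integral Omega mu (fun x => phi x + psi x) =
    elementary_integral Omega mu phi + elementary_integral Omega mu psi.
Proof.
move=> ephi epsi; have [T [r [s [D [pr ps]]]]] := elementary_common ephi epsi.
have prs : step_partition (fun x => phi x + psi x) (fun i => r i + s i) D.
  case: pr ps => r0 OD tD cD phiE [s0 _ _ _ psiE]; split => // [i|i x Dx].
    exact: addr_ge0.
  by rewrite (phiE i)// (psiE i).
split; first exact: step_partition_elementary prs.
rewrite (elementary_integralE pr) (elementary_integralE ps).
rewrite (elementary_integralE prs) -big_split; apply: eq_bigr => i _.
by apply: ext_scaleDl; [case: pr|case: ps].
Qed.

Lemma elementaryZ (a : R) phi : 0 <= a -> elementary Omega phi ->
  elementary Omega (fun x => a * phi x) /\
  elementary_integral Omega mu (fun x => a * phi x) =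
    ext_scale a (elementary_integral Omega mu phi).
Proof.
move=> a0 /elementaryP[T [r [D pr]]].
have par : step_partition (fun x => a * phi x) (fun i => a * r i) D.
  case: pr => r0 OD tD cD phiE; split => // [i|i x Dx]; first exact: mulr_ge0.
  by rewrite (phiE i).
split; first exact: step_partition_elementary par.
rewrite (elementary_integralE pr) (elementary_integralE par) ext_scale_sum.
by apply: eq_bigr => i _; rewrite ext_scaleA.
Qed.

Lemma elementary_max phi psi : elementary Omega phi -> elementary Omega psi ->
  elementary Omega (fun x => Num.max (phi x) (psi x)).
Proof.
move=> ephi epsi; have [T [r [s [D [pr ps]]]]] := elementary_common ephi epsi.
apply: (@step_partition_elementary _ _ (fun i => Num.max (r i) (s i)) D).
case: pr ps => r0 OD tD cD phiE [s0 _ _ _ psiE]; split => // [i|i x Dx].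
  by rewrite le_max r0.
by rewrite (phiE i)// (psiE i).
Qed.

Lemma elementary_restrict (T : finType) phi (r : T -> R) (D : T -> set X)
    (A : set X) : step_partition phi r D -> Omega A ->
  elementary Omega (fun x => phi x * \1_A x) /\
  elementary_integral Omega mu (fun x => phi x * \1_A x) =
    \sum_i ext_scale (r i) (mu (D i `&` A)).
Proof.
move=> [r0 OD tD cD phiE] OA.
pose s (k : T * bool) := if k.2 then r k.1 else 0.
pose C (k : T * bool) := D k.1 `&` if k.2 then A else ~` A.
have pC : step_partition (fun x => phi x * \1_A x) s C.
  split.
  - by move=> [i b]; rewrite /s /=; case: b.
  - move=> [i []]; apply: sigma_algebra_setI => //; exact: sigma_algebra_setC.
  - move=> [i b] [j c] _ _ [x [[/= Di Ab] [Dj Ac]]].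
    congr (_, _); first by apply: tD => //; exists x.
    by move: {Dj} Ab Ac; case: b; case: c.
  - apply/seteqP; split => // x _.
    have [i _ Dx] : (\bigcup_i D i) x by rewrite cD.
    by have [Ax|nAx] := pselect (A x); [exists (i, true)|exists (i, false)].
  - move=> [i []] x [/= Dx Ax]; rewrite indicE /s /=.
      by rewrite mem_set// mulr1 (phiE i).
    by rewrite memNset// mulr0.
split; first exact: step_partition_elementary pC.
rewrite (elementary_integralE pC).
rewrite -(pair_bigA _ (fun i b => ext_scale (s (i, b)) (mu (C (i, b))))) /=.
by apply: eq_bigr => i _; rewrite big_bool /= /s /= ext_scale0l addr0.
Qed.

Hypothesis hE : sigma_monotone_complete [set: E].

(** The core estimate. The set A n where c phi <= f n, for a fixed c < 1,
    increases to X: at a point with phi x > 0 one has c phi x < phi x, so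
    c phi x is not an upper bound of the f n x. By continuity of mu from below
    the integrals of c phi 1_(A n) increase to c times the integral of phi,
    and each of them is at most S because c phi 1_(A n) <= f n. Finally c
    tends to 1 by the Archimedean property. *)
Lemma elementary_integral_below_sup phi (f : nat -> X -> R) (S : infext E) :
  elementary Omega phi ->
  (forall n, measurable_wrt Omega (f n)) -> (forall n x, 0 <= f n x) ->
  (forall x, nondecreasing_seq (f ^~ x)) ->
  (forall x y, ubound (range (f ^~ x)) y -> phi x <= y) ->
  (forall n chi, elementary Omega chi -> (forall x, chi x <= f n x) ->
    elementary_integral Omega mu chi <= S) ->
  elementary_integral Omega mu phi <= S.
Proof.
move=> ephi mf f0 f_nd phif IS.
apply: ext_archimedean => // [|k]; first exact: elementary_integral_ge0.
set c : R := 1 - _.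
have c0 : 0 <= c by rewrite subr_ge0 invf_le1// ler1n.
have c1 : c < 1 by rewrite gtrBl invr_gt0.
pose A n := [set x | c * phi x <= f n x].
have OA n : Omega (A n).
  apply: measurable_wrt_le => //; apply: measurable_wrtZ.
  exact: elementary_measurable.
have A_nd m n : (m <= n)%N -> A m `<=` A n.
  by move=> mn x /= /le_trans; apply; exact: f_nd.
have cA : \bigcup_n A n = setT.
  apply/seteqP; split => // x _; apply: contrapT => nA.
  have phi_c : phi x <= c * phi x.
    apply: phif => _ [n _ <-]; rewrite leNgt; apply/negP => lt.
    by apply: nA; exists n => //=; exact: ltW.
  apply: nA; exists 0 => //=; apply: le_trans (f0 0 x).
  have := elementary_ge0 x ephi; rewrite le_eqVlt => /predU1P[<-|phi0].
    by rewrite mulr0.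
  by move: phi_c; rewrite -{1}[phi x]mul1r ler_pM2r// leNgt c1.
have [T [r [D pD]]] := elementaryP ephi.
have [r0 OD tD cD phiE] := pD.
have sup_phi : supremums
    (range (fun n => \sum_i ext_scale (r i) (mu (D i `&` A n))))
    (elementary_integral Omega mu phi).
  rewrite (elementary_integralE pD); apply: ext_sup_sum => i.
    move=> m n mn; apply: ext_ler_wpZ2l => //.
    apply: (measure_le hOmega hmu); [exact: sigma_algebra_setI..|].
    by apply: setIS; exact: A_nd.
  apply: ext_supZ => //; rewrite -[in mu (D i)](setIT (D i)) -cA setI_bigcupr.
  apply: (measure_cvg_below hOmega hmu) => [n|m n mn].
    exact: sigma_algebra_setI.
  by apply: setIS; exact: A_nd.
apply: (ext_supZ c0 sup_phi).2 => _ [n _ <-].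
have [eA <-] := elementary_restrict pD (OA n).
have [ecA <-] := elementaryZ c0 eA.
apply: (IS n) => // x; rewrite indicE.
case: (boolP (x \in A n)) => [/set_mem|_]; first by rewrite mulr1.
by rewrite !mulr0.
Qed.

End elementary_functions.

(** * The integral of nonnegative functions *)

Section nonnegative_integral.
Context {R : realType} {E : porderLmodType R} {X : Type}.
Context {Omega : set (set X)} {mu : set X -> infext E}.
Hypotheses (hOmega : sigma_algebra [set: X] Omega) (hmu : is_measure Omega mu).
Hypothesis hE : sigma_monotone_complete [set: E].
Implicit Types (f g : X -> R).

Local Notation eint := (elementary_integral Omega mu).
Local Notation oint f := (order_integral_ge0 Omega mu (EFin \o f)).

(** An enumeration of the nonnegative rationals; codes of negative rationals,
    and integers that are not codes, give 0. *)
Definition rat_level (n : nat) : R :=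
  Num.max 0 (oapp ratr 0 (unpickle n : option rat)).

(** The largest of the first n levels that is at most f x. This sequence
    increases by construction, and its limit is f x because the rationals are
    dense. *)
Fixpoint level_approx f (n : nat) : X -> R :=
  if n is m.+1 then
    fun x => Num.max (level_approx f m x)
                     (rat_level m * \1_[set y | rat_level m <= f y] x)
  else fun=> 0.

Lemma rat_level_ge0 n : 0 <= rat_level n.
Proof. by rewrite le_max lexx. Qed.

Lemma elementary_scaled_indic (r : R) (A : set X) : 0 <= r -> Omega A ->
  elementary Omega (fun x => r * \1_A x).
Proof.
move=> r0 OA.
exists 1, (fun=> r), (fun=> A); split => // [i j _ _ _|x].
  by rewrite !ord1.
by rewrite big_ord1.
Qed.

Lemma elementary_level_approx f n : measurable_wrt Omega f ->
  elementary Omega (level_approx f n).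
Proof.
move=> mf; elim: n => [|n IH] /=.
  have := elementary_scaled_indic (lexx 0) (sigma_algebra_set0 hOmega).
  by congr elementary; apply/funext => x; rewrite mul0r.
apply: elementary_max => //; apply: elementary_scaled_indic.
  exact: rat_level_ge0.
by apply: measurable_wrt_le => //; exact: measurable_wrt_cst.
Qed.

Lemma nondecreasing_level_approx f x : nondecreasing_seq (level_approx f ^~ x).
Proof. by apply/nondecreasing_seqP => n /=; rewrite le_max lexx. Qed.

Lemma level_approx_sup f x : 0 <= f x ->
  supremums (range (level_approx f ^~ x)) (f x).
Proof.
move=> f0; split.
  move=> _ [n _ <-]; elim: n => [//|n IH] /=; rewrite ge_max IH /= indicE.
  by case: (boolP (_ \in _)) => [/set_mem/=|_]; rewrite ?mulr1 ?mulr0.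
move=> y uy; rewrite leNgt; apply/negP => /rat_in_itvoo[q].
rewrite in_itv/= => /andP[yq qf].
have y0 : 0 <= y by apply: uy; exists 0.
have qE : rat_level (pickle q) = ratr q.
  by rewrite /rat_level pickleK /= max_r// ltW// (le_lt_trans y0).
move: yq; rewrite ltNge => /negP; apply.
apply: le_trans (uy _ (ex_intro2 _ _ (pickle q).+1 I erefl)) => /=.
by rewrite qE le_max indicE mem_set ?mulr1 ?lexx ?orbT//= ltW.
Qed.

Lemma elementary_approx_exists f : measurable_wrt Omega f ->
  (forall x, 0 <= f x) -> exists phi, elementary_approx Omega phi (EFin \o f).
Proof.
move=> mf f0; exists (level_approx f); split.
- by move=> n; exact: elementary_level_approx.
- by move=> x; exact: nondecreasing_level_approx.
- move=> x; apply/cvg_EFin_sup; first exact: nondecreasing_level_approx.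
  exact: level_approx_sup.
Qed.

Lemma elementary_approx_le (phi : nat -> X -> R) f n x :
  elementary_approx Omega phi (EFin \o f) -> phi n x <= f x.
Proof.
by move=> [_ nd /(_ x)/(cvg_EFin_sup _ (nd x))[+ _]]; apply; exists n.
Qed.

Lemma elementary_approx_nondecreasing (phi : nat -> X -> R) f :
  elementary_approx Omega phi (EFin \o f) -> nondecreasing_seq (eint \o phi).
Proof.
move=> [ephi phi_nd _] m n mn.
by apply: elementary_integral_le => // x; exact: phi_nd.
Qed.

Definition elementary_integrals_below f : set (infext E) :=
  [set eint phi | phi in
    [set phi | elementary Omega phi /\ forall x, phi x <= f x]].

(** The supremum along an approximating sequence is intrinsic to f: it is the
    least upper bound of a set that does not mention the sequence. Hence the
    integral does not depend on the choice of the sequence. *)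
Lemma elementary_approx_integral_sup phi f v :
  elementary_approx Omega phi (EFin \o f) ->
  supremums (range (eint \o phi)) v ->
  supremums (elementary_integrals_below f) v.
Proof.
move=> phif [uv lv]; have [ephi phi_nd phi_cvg] := phif; split.
  move=> _ [psi [epsi psif] <-].
  apply: (elementary_integral_below_sup hOmega hmu hE (f := phi)) => //.
  - by move=> n; exact: elementary_measurable.
  - by move=> n x; exact: (elementary_ge0 hOmega).
  - move=> x y uy; apply: le_trans (psif x) _.
    exact: ((cvg_EFin_sup _ (phi_nd x)).1 (phi_cvg x)).2.
  - move=> n chi echi chi_le; apply: (@le_trans _ _ (eint (phi n))).
      exact: elementary_integral_le.
    by apply: uv; exists n.
move=> y uy; apply: lv => _ [n _ <-]; apply: uy; exists (phi n) => //.
by split=> // x; exact: elementary_approx_le.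
Qed.

Lemma order_integral_ge0_sup f : measurable_wrt Omega f ->
  (forall x, 0 <= f x) -> supremums (elementary_integrals_below f) (oint f).
Proof.
move=> mf f0; have [phi phif] := elementary_approx_exists mf f0.
have [v phiv] := ext_sup_exists hE (elementary_approx_nondecreasing phif).
have [|psi [psif]] := @xgetPex _ Infty [set v | exists phi,
  elementary_approx Omega phi (EFin \o f) /\ supremums (range (eint \o phi)) v].
  by exists v, phi.
exact: elementary_approx_integral_sup.
Qed.

Lemma order_integral_ge0_approx phi f :
  measurable_wrt Omega f -> (forall x, 0 <= f x) ->
  elementary_approx Omega phi (EFin \o f) ->
  supremums (range (eint \o phi)) (oint f).
Proof.
move=> mf f0 phif.
have [v phiv] := ext_sup_exists hE (elementary_approx_nondecreasing phif).
have fv := elementary_approx_integral_sup phif phiv.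
by rewrite (is_subset1_supremums (order_integral_ge0_sup mf f0) fv).
Qed.

Lemma order_integral_ge0_le f g :
  measurable_wrt Omega f -> measurable_wrt Omega g ->
  (forall x, 0 <= f x) -> (forall x, f x <= g x) -> oint f <= oint g.
Proof.
move=> mf mg f0 fg; have g0 x : 0 <= g x by exact: le_trans (fg x).
apply: (order_integral_ge0_sup mf f0).2 => _ [phi [ephi phif] <-].
apply: (order_integral_ge0_sup mg g0).1; exists phi => //; split => // x.
exact: le_trans (fg x).
Qed.

Lemma order_integral_ge0_ge0 f : measurable_wrt Omega f ->
  (forall x, 0 <= f x) -> Fin 0 <= oint f.
Proof.
move=> mf f0; have [phi phif] := elementary_approx_exists mf f0.
apply: (@le_trans _ _ (eint (phi 0))).
  by apply: elementary_integral_ge0 => //; case: phif.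
by apply: (order_integral_ge0_approx mf f0 phif).1; exists 0.
Qed.

Lemma order_integral_ge0D f g :
  measurable_wrt Omega f -> measurable_wrt Omega g ->
  (forall x, 0 <= f x) -> (forall x, 0 <= g x) ->
  oint (fun x => f x + g x) = oint f + oint g.
Proof.
move=> mf mg f0 g0.
have [phi phif] := elementary_approx_exists mf f0.
have [psi psig] := elementary_approx_exists mg g0.
have [ephi phi_nd phi_cvg] := phif; have [epsi psi_nd psi_cvg] := psig.
have D n := elementaryD hOmega hmu (ephi n) (epsi n).
have fg : elementary_approx Omega (fun n x => phi n x + psi n x)
    (EFin \o (fun x => f x + g x)).
  split=> [n|x m n mn|x]; first by case: (D n).
    by apply: lerD; [exact: phi_nd|exact: psi_nd].
  by apply: cvgeD (phi_cvg x) (psi_cvg x).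
have fg0 x : 0 <= f x + g x by exact: addr_ge0.
have := order_integral_ge0_approx (measurable_wrtD hOmega mf mg) fg0 fg.
rewrite (_ : _ \o _ = fun n => eint (phi n) + eint (psi n)); last first.
  by apply/funext => n; case: (D n).
move=> sup_fg; apply: is_subset1_supremums sup_fg _.
apply: ext_supD.
- exact: elementary_approx_nondecreasing phif.
- exact: elementary_approx_nondecreasing psig.
- exact: order_integral_ge0_approx.
- exact: order_integral_ge0_approx.
Qed.

Lemma order_integral_ge0Z (a : R) f : 0 <= a -> measurable_wrt Omega f ->
  (forall x, 0 <= f x) ->
  oint (fun x => a * f x) = ext_scale a (oint f).
Proof.
move=> a0 mf f0; have [phi phif] := elementary_approx_exists mf f0.
have [ephi phi_nd phi_cvg] := phif.
have Z n := elementaryZ hOmega hmu a0 (ephi n).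
have af : elementary_approx Omega (fun n x => a * phi n x)
    (EFin \o (fun x => a * f x)).
  split=> [n|x m n mn|x]; first by case: (Z n).
    by apply: ler_wpM2l => //; exact: phi_nd.
  exact: (cvgeZl (y := a%:E) isT (phi_cvg x)).
have af0 x : 0 <= a * f x by exact: mulr_ge0.
have := order_integral_ge0_approx (measurable_wrtZ a mf) af0 af.
rewrite (_ : _ \o _ = fun n => ext_scale a (eint (phi n))); last first.
  by apply/funext => n; case: (Z n).
move=> sup_af; apply: is_subset1_supremums sup_af _.
by apply: ext_supZ => //; exact: order_integral_ge0_approx.
Qed.

(** An upper bound y of the integrals of the u n bounds the integrals of all
    elementary functions below some u n. By [elementary_integral_below_sup] it
    bounds those of all elementary phi <= f, hence the integral of f. *)
Lemma order_integral_ge0_monotone_convergence (u : nat -> X -> R) f :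
  (forall n, measurable_wrt Omega (u n)) -> (forall n x, 0 <= u n x) ->
  (forall x, nondecreasing_seq (u ^~ x)) ->
  (forall x, supremums (range (u ^~ x)) (f x)) ->
  supremums (range (fun n => oint (u n))) (oint f).
Proof.
move=> measu u0 u_nd uf.
have mf : measurable_wrt Omega f.
  exact: (@measurable_wrt_sup _ _ _ hOmega nat u).
have ule n x : u n x <= f x by apply: (uf x).1; exists n.
have f0 x : 0 <= f x by exact: le_trans (u0 0 x) (ule 0 x).
split; first by move=> _ [n _ <-]; exact: order_integral_ge0_le.
move=> y uy; apply: (order_integral_ge0_sup mf f0).2 => _ [phi [ephi phif] <-].
apply: (elementary_integral_below_sup hOmega hmu hE (f := u)) => //.
  by move=> x z uz; apply: le_trans (phif x) _; exact: (uf x).2.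
move=> n chi echi chiu; apply: le_trans (uy _ (ex_intro2 _ _ n I erefl)).
by apply: (order_integral_ge0_sup (measu n) (u0 n)).1; exists chi.
Qed.

(** If an elementary phi <= f has a nonzero coefficient on C i, then f > 0 on
    C i, so that C i is contained in D and mu (C i) = 0. *)
Lemma order_integral_ge0_null f (D : set X) : measurable_wrt Omega f ->
  (forall x, 0 <= f x) -> Omega D -> mu D = Fin 0 ->
  [set x | f x <> 0] `<=` D -> oint f = Fin 0.
Proof.
move=> mf f0 OD D0 fD; apply/le_anti/andP; split; last first.
  exact: order_integral_ge0_ge0.
apply: (order_integral_ge0_sup mf f0).2 => _ [phi [ephi phif] <-].
have [T [r [C pC]]] := elementaryP hOmega ephi.
rewrite (elementary_integralE hOmega hmu pC); case: pC => r0 OC tC cC phiE.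
rewrite big1// => i _; have [->|ri] := eqVneq (r i) 0; first exact: ext_scale0l.
rewrite (_ : mu (C i) = Fin 0) ?ext_scale0r//.
apply/le_anti/andP; split; last exact: (is_measure_ge0 hmu).
rewrite -D0; apply: (measure_le hOmega hmu) => // x Cx; apply: fD => /= fx0.
move: (phif x); rewrite fx0 (phiE i)// => ri0.
by move: ri; rewrite eq_le ri0 r0.
Qed.

End nonnegative_integral.

(** * Spaces of functions closed under absolute values *)

Section function_spaces.
Context {R : realType} {X : Type}.
Implicit Types (f g h : rfct X R) (L I : set (rfct X R)).

Definition rabs f : rfct X R := fun x => `|f x|.

Lemma rfctDE f g x : (f + g) x = f x + g x. Proof. by []. Qed.
Lemma rfctNE f x : (- f) x = - f x. Proof. by []. Qed.
Lemma rfctZE (a : R) f x : (a *: f) x = a * f x. Proof. by []. Qed.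
Lemma rfct0E x : (0 : rfct X R) x = 0. Proof. by []. Qed.
Definition rfctE := (rfctDE, rfctNE, rfctZE, rfct0E).

Lemma rfct_ge0P f : 0 <= f <-> forall x, 0 <= f x.
Proof. by split => [/rfct_leP|f0]; [|apply/rfct_leP]. Qed.

Lemma sup_in_unique {d} {V : porderType d} (L S : set V) (a b : V) :
  sup_in L S a -> sup_in L S b -> a = b.
Proof.
by move=> [ua la] [ub lb]; apply/le_anti/andP; split; [exact: la|exact: lb].
Qed.

Lemma sup_in_pointwise L (T : Type) (u : T -> rfct X R) h :
  L h -> (forall x, supremums (range (u ^~ x)) (h x)) -> sup_in L (range u) h.
Proof.
move=> Lh uh; split.
  split=> // _ [n _ <-]; apply/rfct_leP => x; apply: (uh x).1; by exists n.
move=> k [_ ku]; apply/rfct_leP => x; apply: (uh x).2 => _ [n _ <-].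
by have /rfct_leP := ku _ (imageT u n); exact.
Qed.

Section abs_closed.
Variable L : set (rfct X R).
Hypotheses (L_sub : is_subspace L) (L_abs : forall f, L f -> L (rabs f)).

Lemma subspace0 : L 0.
Proof. by case: L_sub => /set_mem. Qed.

Lemma subspaceP (a : R) f g : L f -> L g -> L (a *: f + g).
Proof.
by case: L_sub => _ h Lf Lg; apply: set_mem; apply: h; exact: mem_set.
Qed.

Lemma subspaceD f g : L f -> L g -> L (f + g).
Proof. by move=> Lf Lg; rewrite -[f]scale1r; exact: subspaceP. Qed.

Lemma subspaceZ (a : R) f : L f -> L (a *: f).
Proof.
move=> Lf; rewrite -[a *: f]addr0; apply: subspaceP => //; exact: subspace0.
Qed.

Lemma subspaceN f : L f -> L (- f).
Proof. by rewrite -scaleN1r; exact: subspaceZ. Qed.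

Lemma subspaceB f g : L f -> L g -> L (f - g).
Proof. by move=> Lf Lg; apply: subspaceD => //; exact: subspaceN. Qed.

Lemma subspace_max f g : L f -> L g -> L (fun x => Num.max (f x) (g x)).
Proof.
move=> Lf Lg; rewrite (_ : (fun _ => _) = 2^-1 *: (f + g + rabs (f - g))).
  by apply/subspaceZ/subspaceD; [exact: subspaceD|apply/L_abs/subspaceB].
by apply/funext => x; rewrite maxr_absE mulrC.
Qed.

(** Since max (a, b) = (a + b + |a - b|) / 2, the pointwise maximum stays in L,
    and it is then the supremum for the order of L. *)
Lemma sup_in_max f g : L f -> L g ->
  sup_in L [set f; g] (fun x => Num.max (f x) (g x)).
Proof.
move=> Lf Lg; split.
  split; first exact: subspace_max.
  by move=> _ [->|->]; apply/rfct_leP => x; rewrite le_max lexx ?orbT.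
move=> h [_ hfg]; apply/rfct_leP => x; rewrite ge_max.
have /rfct_leP -> : f <= h by apply: hfg; left.
by have /rfct_leP -> : g <= h by apply: hfg; right.
Qed.

Lemma abs_closed_vector_lattice : vector_lattice L.
Proof.
split=> // f g Lf Lg; split.
  by exists (fun x => Num.max (f x) (g x)); exact: sup_in_max.
pose m : rfct X R := fun x => Num.max ((- f) x) ((- g) x).
have [[Lm fgm] m_le] : sup_in L [set - f; - g] m.
  by apply: sup_in_max; exact: subspaceN.
exists (- m); split.
  split; first exact: subspaceN.
  move=> _ [->|->]; apply/rfct_leP => x; rewrite !rfctE lerNl.
    by have /rfct_leP := fgm (- f) (or_introl erefl); exact.
  by have /rfct_leP := fgm (- g) (or_intror erefl); exact.
move=> h [Lh hfg].
have /rfct_leP mh : m <= - h.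
  apply: m_le; split; first exact: subspaceN.
  by move=> _ [->|->]; apply: polmod_leN2; apply: hfg; [left|right].
by apply/rfct_leP => x; rewrite !rfctE lerNr; exact: mh.
Qed.

(** The modulus computed in L is the pointwise absolute value: it is the
    supremum of f and - f, which is their pointwise maximum. *)
Lemma is_modulusE f h : L f -> is_modulus L f h -> h = rabs f.
Proof.
move=> Lf fh.
have := sup_in_max Lf (subspaceN Lf) => /(sup_in_unique fh) ->.
by apply/funext => x; rewrite rfctE maxrN.
Qed.

End abs_closed.

Lemma abs_closed_order_ideal L I :
  is_subspace L -> (forall f, L f -> L (rabs f)) -> I `<=` L -> is_subspace I ->
  (forall f g, I f -> L g -> (forall x, `|g x| <= `|f x|) -> I g) ->
  order_ideal L I.
Proof.
move=> L_sub L_abs IL I_sub I_solid; split => //.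
  exact: abs_closed_vector_lattice.
move=> f g af ag If Lg /(is_modulusE L_sub L_abs (IL _ If)) ->.
by move=> /(is_modulusE L_sub L_abs Lg) -> /rfct_leP; exact: I_solid.
Qed.

End function_spaces.

(** * Integrable functions and null functions *)

Section integrable_functions.
Context {R : realType} {E : porderLmodType R} {X : Type}.
Context {Omega : set (set X)} {mu : set X -> infext E}.
Hypotheses (hOmega : sigma_algebra [set: X] Omega) (hmu : is_measure Omega mu).
Hypothesis hE : sigma_monotone_complete [set: E].
Implicit Types (f g h : rfct X R).

Local Notation oint f := (order_integral_ge0 Omega mu (EFin \o f)).
Local Notation M := (Mspace (R := R) Omega).
Local Notation L1 := (L1space (R := R) Omega mu).
Local Notation N := (Nspace (R := R) Omega mu).
Local Notation T := (order_integral Omega mu).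

Lemma Mspace_subspace : is_subspace M.
Proof.
split=> [|a f g /set_mem mf /set_mem mg]; apply: mem_set.
  exact: measurable_wrt_cst.
by apply: (measurable_wrtD hOmega) mg; exact: measurable_wrtZ.
Qed.

Lemma Mspace_abs f : M f -> M (rabs f).
Proof. exact: measurable_wrt_norm. Qed.

Lemma L1space_dominated f g :
  L1 f -> M g -> (forall x, `|g x| <= `|f x|) -> L1 g.
Proof.
move=> [mf [e fe]] mg gf; split => //.
have : oint (rabs g) <= Fin e.
  rewrite -fe; apply: (order_integral_ge0_le hOmega hmu hE) => [|||//].
  - exact: Mspace_abs.
  - exact: Mspace_abs.
  - by move=> x; exact: normr_ge0.
by move=> ge; have [a gE _] := ext_leFinP ge; exists a.
Qed.

Lemma L1space_subspace : is_subspace L1.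
Proof.
split=> [|a f g /set_mem L1f /set_mem L1g]; apply: mem_set.
  split; first exact: measurable_wrt_cst.
  exists 0; apply: (order_integral_ge0_null hOmega hmu hE (D := set0)) => //.
  - by apply: (@Mspace_abs 0); exact: measurable_wrt_cst.
  - exact: sigma_algebra_set0.
  - exact: (is_measure0 hmu).
  - by move=> x /=; rewrite normr0.
have [[mf [e fe]] [mg [e' ge]]] := (L1f, L1g).
have mfg : M (a *: f + g).
  by apply: (measurable_wrtD hOmega) mg; exact: measurable_wrtZ.
split => //.
have : oint (rabs (a *: f + g)) <= oint (fun x => `|a| * rabs f x + rabs g x).
  apply: (order_integral_ge0_le hOmega hmu hE) => [|||x].
  - exact: Mspace_abs.
  - apply: (measurable_wrtD hOmega); last exact: Mspace_abs.
    by apply: measurable_wrtZ; exact: Mspace_abs.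
  - by move=> x; exact: normr_ge0.
  - by rewrite /rabs !rfctE -normrM; exact: ler_normD.
rewrite (order_integral_ge0D hOmega hmu hE); last 4 first.
- by apply: measurable_wrtZ; exact: Mspace_abs.
- exact: Mspace_abs.
- by move=> x; rewrite mulr_ge0 ?normr_ge0.
- by move=> x; exact: normr_ge0.
rewrite (order_integral_ge0Z hOmega hmu hE)//; last 2 first.
- exact: Mspace_abs.
- by move=> x; exact: normr_ge0.
rewrite [oint (rabs f)]fe [oint (rabs g)]ge => le_fin.
by have [b fgE _] := ext_leFinP le_fin; exists b.
Qed.

Lemma L1space_abs f : L1 f -> L1 (rabs f).
Proof.
move=> L1f; apply: (L1space_dominated L1f); first exact: Mspace_abs L1f.1.
by move=> x; rewrite normr_id.
Qed.

Lemma L1space_order_ideal : order_ideal M L1.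
Proof.
apply: abs_closed_order_ideal.
- exact: Mspace_subspace.
- exact: Mspace_abs.
- by move=> f [].
- exact: L1space_subspace.
- exact: L1space_dominated.
Qed.

Lemma L1space_between f g h : L1 f -> L1 g -> M h -> f <= h -> h <= g -> L1 h.
Proof.
move=> L1f L1g mh /rfct_leP fh /rfct_leP hg.
apply: (@L1space_dominated (rabs f + rabs g)) => //.
  by apply: subspaceD; [exact: L1space_subspace|exact: L1space_abs..].
move=> x; rewrite rfctE (ger0_norm (addr_ge0 _ _)) ?normr_ge0// /rabs.
rewrite ler_norml; apply/andP; split.
  rewrite lerNl; apply: le_trans (_ : - f x <= _); first by rewrite lerN2.
  by rewrite -[leLHS]addr0 lerD// -normrN ler_norm.
apply: (le_trans (hg x)); rewrite -[leLHS]add0r lerD//; exact: ler_norm.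
Qed.

Lemma pointwise_sup_exists (u : nat -> rfct X R) (b : rfct X R) :
  (forall n, u n <= b) ->
  exists h : rfct X R, (forall x, supremums (range (u ^~ x)) (h x)) /\ h <= b.
Proof.
move=> ub; have hu x : has_ubound (range (u ^~ x)).
  by exists (b x) => _ [n _ <-]; have /rfct_leP := ub n; exact.
have uh x : supremums (range (u ^~ x)) (sup (range (u ^~ x))).
  split; first exact: ub_le_sup.
  by move=> y uy; apply: ge_sup => //; exists (u 0 x), 0.
exists (fun x => sup (range (u ^~ x))); split => //.
apply/rfct_leP => x; apply: (uh x).2 => _ [n _ <-].
by have /rfct_leP := ub n; exact.
Qed.

(** The pointwise supremum h satisfies u 0 <= h <= b and is measurable as a
    countable supremum, so it is integrable. By [sup_in_pointwise] it is the
    supremum in L^1. *)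
Lemma L1space_pointwise_sup (u : nat -> rfct X R) b :
  (forall n, L1 (u n)) -> L1 b -> (forall n, u n <= b) ->
  exists h, [/\ L1 h, h <= b & forall x, supremums (range (u ^~ x)) (h x)].
Proof.
move=> L1u L1b ub; have [h [uh hb]] := pointwise_sup_exists ub.
exists h; split => //; apply: (L1space_between (L1u 0) L1b) => //.
  by apply: (@measurable_wrt_sup _ _ _ hOmega nat u) => // n; have [] := L1u n.
by apply/rfct_leP => x; apply: (uh x).1; exists 0.
Qed.

Lemma L1space_sigma_Dedekind_complete : sigma_Dedekind_complete L1.
Proof.
move=> S b SL1 [f Sf] cS L1b Sb.
have [u SE] : exists u : nat -> rfct X R, S = range u.
  have [S0|[u]] := pfcard_geP cS; first by rewrite S0 in Sf.
  exists u; apply/seteqP; split=> [g /(@surj _ _ _ _ u)//|_ [n _ <-]].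
  exact: funS.
have Su n : S (u n) by rewrite SE; exists n.
have [h [L1h _ uh]] := L1space_pointwise_sup (fun n => SL1 _ (Su n)) L1b
  (fun n => Sb _ (Su n)).
by exists h; rewrite SE; exact: sup_in_pointwise.
Qed.

Lemma order_integral_ge0_fin f :
  L1 f -> 0 <= f -> oint f = Fin (fin_val (oint f)).
Proof.
move=> [_ [e fe]] /rfct_ge0P f0.
suff -> : EFin \o f = (fun x => `|f x|%:E) by rewrite fe.
by apply/funext => x /=; rewrite ger0_norm.
Qed.

Lemma fin_val_integralD f g : L1 f -> L1 g -> 0 <= f -> 0 <= g ->
  fin_val (oint (f + g)) = fin_val (oint f) + fin_val (oint g).
Proof.
move=> L1f L1g f0 g0.
rewrite [oint (f + g)](order_integral_ge0D hOmega hmu hE).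
- by rewrite (order_integral_ge0_fin L1f f0) (order_integral_ge0_fin L1g g0).
- exact: L1f.1.
- exact: L1g.1.
- exact/rfct_ge0P.
- exact/rfct_ge0P.
Qed.

Lemma fin_val_integralZ (a : R) f : 0 <= a -> L1 f -> 0 <= f ->
  fin_val (oint (a *: f)) = a *: fin_val (oint f).
Proof.
move=> a0 L1f f0.
rewrite [oint (a *: f)](order_integral_ge0Z hOmega hmu hE) //.
- by rewrite (order_integral_ge0_fin L1f f0).
- exact: L1f.1.
- exact/rfct_ge0P.
Qed.

(** If f1 - f2 = g1 - g2 then f1 + g2 = g1 + f2, and additivity on nonnegative
    functions gives the same value for both decompositions. *)
Lemma order_integral_decomp f f1 f2 : L1 f1 -> 0 <= f1 -> L1 f2 -> 0 <= f2 ->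
  f = f1 - f2 -> T f = fin_val (oint f1) - fin_val (oint f2).
Proof.
move=> L1f1 f10 L1f2 f20 fE; apply: xget_unique.
  by exists f1, f2.
move=> _ [g1 [g2 [[L1g1 g10] [L1g2 g20] gE ->]]].
have fg : f1 + g2 = g1 + f2.
  by rewrite -[f1](subrK f2) -fE gE addrAC subrK.
apply/eqP; rewrite subr_eq addrAC eq_sym subr_eq -!fin_val_integralD//.
by rewrite fg.
Qed.

(** The decomposition f = (|f| + f) - |f| is simpler to handle than the one
    into positive and negative parts. *)
Lemma L1space_decomp f : L1 f ->
  exists f1 f2, [/\ L1 f1 /\ 0 <= f1, L1 f2 /\ 0 <= f2 & f = f1 - f2].
Proof.
move=> L1f; exists (rabs f + f), (rabs f); split.
- split.
    apply: subspaceD => //; first exact: L1space_subspace.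
    exact: L1space_abs.
  by apply/rfct_ge0P => x; rewrite rfctE -lerBlDr sub0r /rabs -normrN ler_norm.
- by split; [exact: L1space_abs|apply/rfct_ge0P => x; exact: normr_ge0].
- by rewrite addrAC subrr add0r.
Qed.

Lemma order_integral_nonneg f : L1 f -> 0 <= f -> T f = fin_val (oint f).
Proof.
move=> L1f f0; have L10 : L1 0 by apply: subspace0; exact: L1space_subspace.
rewrite (@order_integral_decomp f f 0) ?subr0//.
suff -> : fin_val (oint 0) = 0 by rewrite subr0.
by have := fin_val_integralZ (lexx 0) L10 (lexx 0); rewrite !scale0r.
Qed.

Lemma order_integralD f g : L1 f -> L1 g -> T (f + g) = T f + T g.
Proof.
move=> /L1space_decomp[f1 [f2 [[L1f1 f10] [L1f2 f20] fE]]].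
move=> /L1space_decomp[g1 [g2 [[L1g1 g10] [L1g2 g20] gE]]].
have L1D h k : L1 h -> L1 k -> L1 (h + k).
  by apply: subspaceD; exact: L1space_subspace.
have D0 h k : 0 <= h -> 0 <= k -> 0 <= h + k.
  by move=> h0 k0; rewrite -[leLHS]addr0; exact: polmod_leD.
rewrite (order_integral_decomp L1f1 f10 L1f2 f20 fE).
rewrite (order_integral_decomp L1g1 g10 L1g2 g20 gE).
rewrite (@order_integral_decomp _ (f1 + g1) (f2 + g2)); last first.
- by rewrite fE gE opprD addrACA.
- exact: D0.
- exact: L1D.
- exact: D0.
- exact: L1D.
by rewrite !fin_val_integralD// opprD addrACA.
Qed.

Lemma order_integralZ (a : R) f : L1 f -> T (a *: f) = a *: T f.
Proof.
move=> /L1space_decomp[f1 [f2 [[L1f1 f10] [L1f2 f20] fE]]].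
have L1Z b h : L1 h -> L1 (b *: h).
  by apply: subspaceZ; exact: L1space_subspace.
rewrite (order_integral_decomp L1f1 f10 L1f2 f20 fE).
have [a0|/ltW a0] := leP 0 a.
  rewrite (@order_integral_decomp _ (a *: f1) (a *: f2)); last first.
  - by rewrite fE scalerBr.
  - exact: polmod_scale_ge0.
  - exact: L1Z.
  - exact: polmod_scale_ge0.
  - exact: L1Z.
  by rewrite !fin_val_integralZ// scalerBr.
have Na0 : 0 <= - a by rewrite oppr_ge0.
rewrite (@order_integral_decomp _ ((- a) *: f2) ((- a) *: f1)); last first.
- by rewrite fE !scaleNr opprK scalerBr addrC.
- exact: polmod_scale_ge0.
- exact: L1Z.
- exact: polmod_scale_ge0.
- exact: L1Z.
by rewrite !fin_val_integralZ// !scaleNr opprK scalerBr addrC.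
Qed.

Lemma order_integral_positive : positive_operator L1 T.
Proof.
split=> [a f g L1f L1g|f L1f f0].
  rewrite order_integralD ?order_integralZ//.
  by apply: subspaceZ => //; exact: L1space_subspace.
rewrite order_integral_nonneg// -ext_leFin -order_integral_ge0_fin//.
apply: (order_integral_ge0_ge0 hOmega hmu hE); first exact: L1f.1.
exact/rfct_ge0P.
Qed.

(** If u n decreases to 0 in L^1, then u 0 - u n increases to some h <= u 0
    pointwise, with h in L^1. As u 0 - h is a lower bound of the u n in L^1, it
    is at most 0, whence h = u 0; monotone convergence applies to u 0 - u n. *)
Lemma order_integral_sigma_order_continuous : sigma_order_continuous L1 T.
Proof.
move=> u L1u [u_ni [[_ u_lb] u_glb]].
have L1_sub := L1space_subspace.
have u0 n : 0 <= u n by apply: u_lb; exists n.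
pose v n := u 0 - u n.
have L1v n : L1 (v n) by exact: subspaceB.
have v0 n : 0 <= v n by rewrite polmod_subr_ge0; exact: u_ni.
have vu n : v n <= u 0.
  by rewrite -[leRHS]subr0; apply: polmod_leD => //; exact: polmod_leN2.
have [h [L1h hu vh]] := L1space_pointwise_sup L1v (L1u 0) vu.
have hE' : h = u 0.
  apply/le_anti/andP; split => //; rewrite -polmod_subr_ge0 -opprB.
  rewrite -[leLHS]oppr0; apply: polmod_leN2; apply: u_glb; split.
    exact: subspaceB.
  move=> _ [n _ <-]; apply/rfct_leP => x; rewrite !rfctE lerBlDr -lerBlDl.
  by apply: (vh x).1; exists n.
have v_nd x : nondecreasing_seq (v ^~ x).
  move=> m n mn; rewrite /v !rfctE lerD2l lerN2.
  by have /rfct_leP := u_ni _ _ mn; exact.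
have := order_integral_ge0_monotone_convergence hOmega hmu hE
  (fun n => (L1v n).1) (fun n => (rfct_ge0P (v n)).1 (v0 n)) v_nd vh.
rewrite hE' => -[_ mct].
have Tu n : T (u n) = T (u 0) - T (v n).
  have -> : T (u 0) = T (v n) + T (u n) by rewrite -order_integralD// subrK.
  by rewrite addrAC subrr add0r.
have [_ T0] := order_integral_positive.
split=> [m n mn /=|].
  rewrite -polmod_subr_ge0 -scaleN1r -order_integralZ//.
  rewrite -order_integralD//; last exact: subspaceZ.
  apply: T0; first by apply: subspaceD => //; exact: subspaceZ.
  by rewrite scaleN1r polmod_subr_ge0; exact: u_ni.
split; first by split => // _ [n _ <-] /=; exact: T0.
move=> y [_ yT].
have : oint (u 0) <= Fin (T (u 0) - y).
  apply: mct => _ [n _ <-]; rewrite order_integral_ge0_fin//.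
  rewrite -order_integral_nonneg// ext_leFin polmod_leBrDr addrC.
  by rewrite -polmod_leBrDr -Tu; apply: yT; exists n.
rewrite order_integral_ge0_fin// -order_integral_nonneg// ext_leFin.
by rewrite polmod_leBrDr addrC -polmod_leBrDr subrr.
Qed.

Lemma Nspace_dominated f g :
  N f -> M g -> (forall x, `|g x| <= `|f x|) -> N g.
Proof.
move=> [_ [D [OD D0 fD]]] mg gf; split => //; exists D; split => // x gx.
apply: fD => fx; apply: gx; apply/eqP; rewrite -normr_le0.
by have := gf x; rewrite fx normr0.
Qed.

Lemma Nspace_subspace : is_subspace N.
Proof.
split=> [|a f g /set_mem[mf [D [OD D0 fD]]] /set_mem[mg [C [OC C0 gC]]]];
  apply: mem_set; split.
- exact: measurable_wrt_cst.
- exists set0; split; [exact: sigma_algebra_set0|exact: is_measure0 hmu|].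
  by move=> x /=; case.
- by apply: (measurable_wrtD hOmega) mg; exact: measurable_wrtZ.
exists (D `|` C); split.
- exact: sigma_algebra_setU.
- exact: (null_setU hOmega hmu).
move=> x /= fgx; apply: contrapT => /not_orP[nD nC]; apply: fgx.
have fx : f x = 0 by apply: contrapT => /fD.
have gx : g x = 0 by apply: contrapT => /gC.
by rewrite !rfctE fx gx mulr0 addr0.
Qed.

Lemma Nspace_sub_L1space : N `<=` L1.
Proof.
move=> f [mf [D [OD D0 fD]]]; split => //; exists 0.
apply: (order_integral_ge0_null hOmega hmu hE (f := rabs f) (D := D)) => //.
- exact: Mspace_abs.
- by move=> x; exact: normr_ge0.
by move=> x /= fx; apply: fD => /= fx0; apply: fx; rewrite /rabs fx0 normr0.
Qed.

(** The supremum f of the u n in L^1 is their pointwise supremum, so f vanishes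
    outside the union of the null sets that carry the u n. *)
Lemma Nspace_sigma_order_ideal : sigma_order_ideal L1 N.
Proof.
split.
  apply: abs_closed_order_ideal.
  - exact: L1space_subspace.
  - exact: L1space_abs.
  - exact: Nspace_sub_L1space.
  - exact: Nspace_subspace.
  - by move=> f g Nf [mg _]; exact: Nspace_dominated.
move=> u f Nu u0 L1f [_ uf]; split; first exact: L1f.1.
have uf_le n : u n <= f by apply: uf.1.2; exists n.
have L1u n : L1 (u n) by exact: Nspace_sub_L1space.
have [h [L1h _ uh]] := L1space_pointwise_sup L1u L1f uf_le.
have fE : f = h := sup_in_unique uf (sup_in_pointwise L1h uh).
have [D uD] := choice (fun n => (Nu n).2).
exists (\bigcup_n D n); split.
- by apply: (sigma_algebra_bigcupT hOmega) => n; case: (uD n).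
- by apply: (null_bigcup hOmega hmu) => n; case: (uD n).
move=> x /= fx; apply: contrapT => nD; apply: fx.
have ux n : u n x = 0.
  apply: contrapT => unx; apply: nD; exists n => //.
  by case: (uD n) => _ _; exact.
have range0 : range (u ^~ x) = [set 0].
  by apply/seteqP; split => [_ [n _ <-]|_ ->]; [exact: ux|exists 0].
by have := uh x; rewrite range0 supremums1 -fE.
Qed.

End integrable_functions.

Theorem proposition6p14 (R : realType) (X : Type) (Omega : set (set X))
    (E : porderLmodType R) (mu : set X -> infext E)
    (hOmega : sigma_algebra [set: X] Omega)
    (hE : sigma_monotone_complete [set: E])
    (hmu : is_measure Omega mu) :
  (order_ideal (Mspace (R := R) Omega) (L1space Omega mu) /\
   vector_lattice (L1space Omega mu) /\
   sigma_Dedekind_complete (L1space Omega mu)) /\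
  (positive_operator (L1space Omega mu) (order_integral Omega mu) /\
   sigma_order_continuous (L1space Omega mu) (order_integral Omega mu)) /\
  sigma_order_ideal (L1space Omega mu) (Nspace Omega mu).
Proof.
split; [split; [|split]|split; [split|]].
- exact: L1space_order_ideal.
- apply: abs_closed_vector_lattice; first exact: L1space_subspace.
  exact: L1space_abs.
- exact: L1space_sigma_Dedekind_complete.
- exact: order_integral_positive.
- exact: order_integral_sigma_order_continuous.
- exact: Nspace_sigma_order_ideal.
Qed.
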